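(* Let $n\ge 2$, let $f,g:[0,2]\to\mathbb{R}$ be Lipschitz-continuous functions with $g$ nonnegative and $g(t)=0$ if and only if $t=0$, and let $\mathcal{F}=\mathcal{F}_{f,g}$ be the associated functional on $\mathcal{S}^n$. Then there exists $\Lambda>0$ such that any minimizer $E\in\mathcal{S}^n$ of $\mathcal{F}$ with $|E|=|B|$ is a $\Lambda$-minimizer of the perimeter.
   Context: $\mathcal{S}^n$ is the collection of all Borel sets $E\subset\mathbb{R}^n$ with positive and finite Lebesgue measure $|E|$. $B=B(0,1)$ is the open unit ball of $\mathbb{R}^n$, and $B_E$ is the open ball centered at $0$ with $|B_E|=|E|$. $P(E,\Omega)$ is the perimeter of $E$ in the open set $\Omega$ in the sense of De Giorgi, $P(E)=P(E,\mathbb{R}^n)$, and $V\bigtriangleup W$ is the symmetric difference. The isoperimetric deficit and Fraenkel asymmetry of $E\in\mathcal{S}^n$ are $$\delta P(E)=\frac{P(E)-P(B_E)}{P(B_E)},\qquad \alpha(E)=\inf\Big\{\frac{|E\bigtriangleup(x+B_E)|}{|B_E|}:\ x\in\mathbb{R}^n\Big\}\in[0,2).$$ The functional $\mathcal{F}_{f,g}:\mathcal{S}^n\to[-\infty,+\infty]$ is $$\mathcal{F}_{f,g}(E)=\frac{\delta P(E)+f(\alpha(E))}{g(\alpha(E))}\quad\text{if }\alpha(E)>0,$$ and, if $\alpha(E)=0$, $\mathcal{F}_{f,g}(E)=\inf\{\liminf_h\mathcal{F}_{f,g}(E_h)\}$, the infimum being over all sequences $(E_h)_h\subset\mathcal{S}^n$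 with $\alpha(E_h)>0$ and $|E_h\bigtriangleup B|\to0$ as $h\to\infty$. A minimizer of $\mathcal{F}$ is a set $E\in\mathcal{S}^n$ with $\mathcal{F}(E)\le\mathcal{F}(F)$ for all $F\in\mathcal{S}^n$. A set $E\subset\mathbb{R}^n$ of locally finite perimeter is a (strong) $\Lambda$-minimizer of the perimeter if there exists $R>0$ such that for all $x\in\mathbb{R}^n$, all $0<r<R$ and all $F$ with $E\bigtriangleup F\subset\subset B(x,r)$ one has $P(E,B(x,r))\le P(F,B(x,r))+\Lambda|E\bigtriangleup F|$. *)

(* Defs.v *)
From HB Require Import structures.
From mathcomp Require Import all_boot all_order all_algebra.
From mathcomp Require Import all_classical all_reals all_analysis.
From mathcomp Require Import measurable_realfun.

Set Implicit Arguments.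
Unset Strict Implicit.
Unset Printing Implicit Defensive.

Import Order.TTheory GRing.Theory Num.Theory.
Import numFieldNormedType.Exports.

Local Open Scope classical_set_scope.
Local Open Scope ring_scope.

(* R^n with its Borel sigma-algebra. *)
Notation eucl R n := (g_sigma_algebraType (@open 'rV[R]_n)).

Section product_image.
Context d1 d2 d (T1 : measurableType d1) (T2 : measurableType d2)
  (T : measurableType d) (R : realType).
Variables (m1 : {sigma_finite_measure set T1 -> \bar R})
  (m2 : {sigma_finite_measure set T2 -> \bar R}).
Variables (f : T1 * T2 -> T) (g : T -> T1 * T2).
Hypotheses (mf : measurable_fun setT f) (mg : measurable_fun setT g)
  (fK : cancel f g).

(* [mf], [mg], [fK] only serve the inference of the measure structure. *)
Definition product_image & measurable_fun setT f & measurable_fun setT g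
  & cancel f g : set T -> \bar R := pushforward (m1 \x m2)%E f.

Local Notation mu := (product_image mf mg fK).

Let mu0 : mu set0 = 0%E.
Proof. by rewrite /product_image /pushforward preimage_set0 measure0. Qed.

Let mu_ge0 A : (0 <= mu A)%E.
Proof. exact: measure_ge0. Qed.

Let mu_sigma_additive : semi_sigma_additive mu.
Proof.
move=> F mF tF mUF; rewrite /product_image /pushforward preimage_bigcup.
apply: measure_semi_sigma_additive.
- by move=> k; rewrite -[X in measurable X]setTI; exact: mf.
- apply/trivIsetP => /= i j _ _ ij; rewrite -preimage_setI.
  by move/trivIsetP : tF => /(_ _ _ _ _ ij) ->//; rewrite preimage_set0.
- by rewrite -preimage_bigcup -[X in measurable X]setTI; exact: mf.
Qed.

HB.instance Definition _ := isMeasure.Build _ _ _ mu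
  mu0 mu_ge0 mu_sigma_additive.

Let mu_sigma_finite : sigma_finite setT mu.
Proof.
have /sigma_finiteP[F [TF ndF Foo]] := sigma_finiteT m1.
have /sigma_finiteP[G [TG ndG Goo]] := sigma_finiteT m2.
exists (fun k => g @^-1` (F k `*` G k)) => [|k].
  apply/esym/seteqP; split => // t _.
  have [k _ Fk] : (\bigcup_k F k) (g t).1 by rewrite -TF.
  have [l _ Gl] : (\bigcup_l G l) (g t).2 by rewrite -TG.
  exists (maxn k l) => //; split => /=.
    by move: Fk; apply/subsetPset/ndF/leq_maxl.
  by move: Gl; apply/subsetPset/ndG/leq_maxr.
have [mF Fk] := Foo k; have [mG Gk] := Goo k; split.
  by rewrite -[X in measurable X]setTI; apply: mg => //; exact: measurableX.
rewrite /product_image /pushforward -comp_preimage.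
rewrite (_ : g \o f = id) ?preimage_id; last first.
  by apply/funext => p /=; rewrite fK.
by rewrite product_measure1E// lte_mul_pinfty// ge0_fin_numE.
Qed.

HB.instance Definition _ := Measure_isSigmaFinite.Build _ _ _ mu
  mu_sigma_finite.

End product_image.

Section tuple_cons.
Variables (R : realType) (n : nat).
Local Notation M := (measurableTypeR R).

Definition tcons (p : M * n.-tuple M) : n.+1.-tuple M := [tuple of p.1 :: p.2].

Definition tuncons (t : n.+1.-tuple M) : M * n.-tuple M :=
  (tnth t ord0, [tuple of behead t]).

Lemma measurable_tcons : measurable_fun setT tcons.
Proof. exact: measurable_cons. Qed.

Lemma measurable_tuncons : measurable_fun setT tuncons.
Proof.
apply/measurable_fun_pair => /=; first exact: measurable_tnth.
exact: measurable_behead.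
Qed.

Lemma tconsK : cancel tcons tuncons.
Proof.
by move=> [x t]; rewrite /tuncons /tcons/=; congr pair; apply: val_inj.
Qed.

End tuple_cons.

Fixpoint leb_tuple (R : realType) (n : nat) :
    {sigma_finite_measure set (n.-tuple (measurableTypeR R)) -> \bar R} :=
  match n with
  | 0 => \d_ [tuple]
  | n'.+1 =>
      product_image lebesgue_measure (leb_tuple R n')
        (@measurable_tcons R n') (@measurable_tuncons R n') (@tconsK R n')
  end.

Section lebesgue.
Variables (R : realType) (n : nat).
Local Notation M := (measurableTypeR R).

Definition row_of_tuple (t : n.-tuple M) : eucl R n := \row_i tnth t i.

Lemma measurable_row_of_tuple : measurable_fun setT row_of_tuple.
Proof.
have @G : set (set (eucl R n)) := @open 'rV[R]_n.
apply: (measurability G) => //.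
move=> _ [U oU <-]; rewrite setTI.
pose q (p : 'rV[rat]_n * nat) : 'rV[R]_n := map_mx ratr p.1.
pose C (p : 'rV[rat]_n * nat) : set (n.-tuple M) :=
  [set t | ball (q p) p.2.+1%:R^-1 `<=` U /\
           forall i, ball (ratr (p.1 0 i) : R) p.2.+1%:R^-1 (tnth t i)].
have -> : row_of_tuple @^-1` U = \bigcup_p C p.
  apply/seteqP; split => [t /= Ut|t [p _ [sU tp]]]; last first.
    apply: sU; split => [|i j]; first by rewrite invr_gt0.
    by rewrite ord1 /row_of_tuple !mxE; exact: tp.
  have /nbhs_ballP[e /= e0 eU] : nbhs (row_of_tuple t : 'rV[R]_n) U.
    exact: open_nbhs_nbhs.
  have [k _ /= ke] : exists2 k : nat, True & k.+1%:R^-1 < e / 2.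
    have := near_infty_natSinv_lt (PosNum (divr_gt0 e0 (ltr0n R 2))).
    by move=> [N _ /(_ N)/= NE]; exists N => //; apply: NE => /=.
  have qe i : {r : rat | `|ratr r - tnth t i| < k.+1%:R^-1}.
    apply/cid.
    have : tnth t i - k.+1%:R^-1 < tnth t i + k.+1%:R^-1 :> R.
      by rewrite ltrBlDr -addrA ltrDl addr_gt0.
    move=> /rat_in_itvoo[r]; rewrite in_itv/= => rt; exists r.
    by rewrite ltr_distl.
  exists (\row_i sval (qe i), k) => //; split; last first.
    by move=> i; rewrite /q /= !mxE; exact: (svalP (qe i)).
  move=> y qy; apply: eU.
  have tq : ball (row_of_tuple t : 'rV[R]_n) (e / 2) (q (\row_i sval (qe i), k)).
    rewrite /ball/=; split => [|i j]; first by rewrite divr_gt0.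
    rewrite ord1 /q /row_of_tuple !mxE /= /ball /= distrC.
    exact: lt_trans (svalP (qe j)) ke.
  rewrite (splitr e); apply: ball_triangle tq _.
  by apply: le_ball qy; exact: ltW.
apply: countable_bigcupT_measurable => [|p]; first exact: countableP.
have [sU|nsU] := pselect (ball (q p) p.2.+1%:R^-1 `<=` U); last first.
  rewrite (_ : C p = set0)//; apply/seteqP; split => // t [].
  by move=> /nsU.
rewrite (_ : C p = \bigcap_(i in [set: 'I_n])
    ((fun t => tnth t i) @^-1` (ball (ratr (p.1 0 i) : R) p.2.+1%:R^-1 : set M))).
  apply: fin_bigcap_measurable => // i _.
  rewrite -[X in measurable X]setTI; apply: measurable_tnth => //.
  exact: measurable_ball.
by apply/seteqP; split => [t [_ H] i _|t H]; [exact: H|split => // i; exact: H].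
Qed.

HB.instance Definition _ :=
  isMeasurableFun.Build _ _ _ _ row_of_tuple measurable_row_of_tuple.

(* On Borel sets: the n-fold product of the Lebesgue measure of R. *)
Definition lebesgue := pushforward (leb_tuple R n) row_of_tuple.

Let lebesgue0 : lebesgue set0 = 0%E.
Proof. exact: measure0. Qed.

Let lebesgue_ge0 A : (0 <= lebesgue A)%E.
Proof. exact: measure_ge0. Qed.

Let lebesgue_sigma_additive : semi_sigma_additive lebesgue.
Proof. exact: measure_semi_sigma_additive. Qed.

HB.instance Definition _ := isMeasure.Build _ _ _ lebesgue
  lebesgue0 lebesgue_ge0 lebesgue_sigma_additive.

End lebesgue.

Section perimeter.
Variables (R : realType) (n : nat).
Implicit Types (E F : set (eucl R n)) (Omega : set 'rV[R]_n).
Local Open Scope ereal_scope.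

(* The norm provided by the library on matrices is the sup norm. *)
Definition enorm (x : 'rV[R]_n) : R := Num.sqrt (\sum_(i < n) x 0 i ^+ 2)%R.

Definition eball (x : 'rV[R]_n) (r : R) : set 'rV[R]_n :=
  [set y | (enorm (y - x) < r)%R].

Definition compactly_contained (A Omega : set 'rV[R]_n) :=
  compact (closure A) /\ closure A `<=` Omega.

(* C^1_c(Omega; R^n): differentiable with continuous Jacobian, and support
   compact in Omega. *)
Definition C1c Omega (T : 'rV[R]_n -> 'rV[R]_n) :=
  [/\ forall x, differentiable T x,
      continuous (jacobian T) &
      compactly_contained [set x | T x != 0%R] Omega].

Definition divergence (T : 'rV[R]_n -> 'rV[R]_n) (x : 'rV[R]_n) : R :=
  \tr ('J T x).

(* De Giorgi perimeter; only meant for E Borel and Omega open. *)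
Definition perimeter_in E Omega : \bar R :=
  ereal_sup [set \int[@lebesgue R n]_(x in E) (divergence T x)%:E |
    T in [set T | C1c Omega T /\ forall x, (enorm (T x) <= 1)%R]].

Definition perimeter E := perimeter_in E setT.

Definition locally_finite_perimeter E :=
  measurable E /\
  forall Omega, open Omega -> bounded_set Omega -> perimeter_in E Omega < +oo.

Definition Lambda_minimizer (Lambda : R) E :=
  locally_finite_perimeter E /\
  exists2 r0 : R, (0 < r0)%R &
    forall (x : 'rV[R]_n) (r : R) F, (0 < r < r0)%R -> measurable F ->
      compactly_contained (E `+` F) (eball x r) ->
      perimeter_in E (eball x r) <=
      perimeter_in F (eball x r) + Lambda%:E * @lebesgue R n (E `+` F).

End perimeter.

Section functional.
Variables (R : realType) (n : nat).
Implicit Types (E F : set (eucl R n)) (f g : R -> R).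
Local Open Scope ereal_scope.
Local Notation leb := (@lebesgue R n).

Definition unit_ball : set (eucl R n) := eball 0 1.

Definition Sn : set (set (eucl R n)) :=
  [set E | measurable E /\ 0 < leb E < +oo].

(* For E in Sn there is exactly one such radius. *)
Definition eq_ball_radius E : R :=
  xget 0%R [set r | (0 < r)%R /\ leb (eball 0 r) = leb E].

Definition eq_ball E : set (eucl R n) := eball 0 (eq_ball_radius E).

Definition deficit E : \bar R :=
  (perimeter E - perimeter (eq_ball E)) / perimeter (eq_ball E).

Definition asymmetry E : R :=
  inf [set fine (leb (E `+` [set (x + y)%R | y in eq_ball E]) / leb (eq_ball E))
      | x in [set: 'rV[R]_n]].

Definition functional_pos f g E : \bar R :=
  (deficit E + (f (asymmetry E))%:E) / (g (asymmetry E))%:E.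

(* The asymmetry is never negative, so the else branch is asymmetry 0. *)
Definition functional f g E : \bar R :=
  if (0 < asymmetry E)%R then functional_pos f g E
  else ereal_inf [set limn_einf (fun h => functional_pos f g (Eh h)) |
    Eh in [set Eh : nat -> set (eucl R n) |
      (forall h, Sn (Eh h) /\ (0 < asymmetry (Eh h))%R) /\
      leb (Eh h `+` unit_ball) @[h --> \oo] --> 0]].

Definition minimizer f g E :=
  Sn E /\ forall F, Sn F -> functional f g E <= functional f g F.

End functional.

(* Main.v *)
Require Import Defs.
From mathcomp Require Import all_boot all_order all_algebra.
From mathcomp Require Import all_classical all_reals all_analysis.
From mathcomp Require Import measurable_realfun ring lra.
Import Order.TTheory GRing.Theory Num.Theory.
Import numFieldNormedType.Exports.
Local Open Scope classical_set_scope.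
Local Open Scope ring_scope.

(** Minimizers of positive asymmetry.  Let E be one, with |E| = |B|, and let m be the
    minimum of the functional.  For F close to E, minimality says that
    deficit(F) >= m g(alpha(F)) - f(alpha(F)), with equality at E.  As f and g are
    Lipschitz and the asymmetry is Lipschitz for the volume of the symmetric difference
    ([asymmetry_transfer]), deficit(E) - deficit(F) is at most C |E + F|, with E + F
    the symmetric difference.  The normalizing perimeters P(B) and P(B_F) differ by the
    same order ([eq_ball_perimeter_le]), and P(E) is bounded by a constant because m is
    the same for all minimizers; hence P(E) <= P(F) + C |E + F|
    ([asymmetric_minimizer_comparison]).  The radius allowed for the competitors
    depends on E: F must be so close to E that its asymmetry is still positive.

    Minimizers of asymmetry zero are limits in volume of translated unit balls, and
    unit balls satisfy P(B) <= P(F) + C |B + F| by calibration: the compactly supported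
    field [calibration] has norm at most 1, extends the outer normal of the sphere and
    has bounded divergence.  The estimate is uniform in the centre and passes to the
    limit ([near_unit_balls_quasiminimal]).

    From global to local.  If E and F differ only inside a ball, then P(E) - P(F) is at
    least P(E, ball) - P(F, ball).  For the De Giorgi perimeter this follows from
    exchanging two test fields outside a neighbourhood of the difference
    ([test_field_exchange]).

    The integral identities used above rest on the behaviour of the Lebesgue measure
    under translations and dilations ([lebesgue_affine]).  Translation invariance gives that the divergence of a compactly supported C1 field
    has integral zero ([Rintegral_divergence0]); with radial cut-offs it yields the
    divergence theorem on balls in the form of an inequality
    ([ball_divergence_le0]), from which the perimeter of a ball of radius r is
    n |B_r| / r ([perimeter_eball]). *)

Set Implicit Arguments.
Unset Strict Implicit.
Unset Printing Implicit Defensive.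

(** * Affine images of the Lebesgue measure *)

Section affine_line.
Context {R : realType}.
Local Notation M := (measurableTypeR R).
Variables (a b : R).
Hypothesis a0 : 0 < a.

Definition affine1 (x : M) : M := a * x + b.

Lemma measurable_affine1 : measurable_fun setT affine1.
Proof.
apply: measurable_funD => //; exact: measurable_funM.
Qed.


(** Both sides are measures, and they agree on half-open intervals. *)
Lemma lebesgue_measure_affine1 (A : set M) : measurable A ->
  lebesgue_measure (affine1 @^-1` A) = (a^-1%:E * lebesgue_measure A)%E.
Proof.
move=> mA.
pose m := mscale (NngNum (ltW a0)) (pushforward lebesgue_measure affine1).
have mE : lebesgue_measure A = m measurable_affine1 A.
  apply: lebesgue_measure_unique => // _ [[x y] _ <-] /=.
  rewrite /m /mscale /= /pushforward.
  have -> : affine1 @^-1` `]x, y]%classic = `](x - b) / a, (y - b) / a]%classic.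
    apply/seteqP; split => z /=; rewrite /affine1 !in_itv/= ltr_pdivrMr// ler_pdivlMr//;
    by rewrite ltrBlDr lerBrDr [z * a]mulrC.
  rewrite !lebesgue_measure_itv /= !lte_fin ltr_pM2r ?invr_gt0//.
  rewrite ltrD2r; case: ifP => // _; last by rewrite mule0.
  by rewrite -EFinM -?EFinD; congr EFin; field; rewrite gt_eqF.
rewrite mE /m /mscale /= muleA -EFinM mulVf ?gt_eqF// mul1e.
by [].
Qed.

End affine_line.

Lemma mule_factors (R : realType) (r s t : R) (p q : \bar R) :
  r * (s * t) = 1 -> (r%:E * ((s%:E * p) * (t%:E * q)) = p * q)%E.
Proof. by move=> rst; rewrite muleACA -(EFinM s t) (muleA r%:E) -(EFinM r) rst mul1e. Qed.

Section affine_tuple.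
Context {R : realType}.
Local Notation M := (measurableTypeR R).
Variable a : R.
Hypothesis a0 : 0 < a.

Definition affine_tuple n (b : n.-tuple M) (t : n.-tuple M) : n.-tuple M :=
  [tuple affine1 a (tnth b i) (tnth t i) | i < n].

Lemma measurable_affine_tuple n (b : n.-tuple M) :
  measurable_fun setT (affine_tuple b).
Proof.
apply/measurable_fun_tnthP => i.
rewrite (_ : _ \o _ = affine1 a (tnth b i) \o (fun t => tnth t i)); last first.
  by apply/funext => t /=; rewrite tnth_mktuple.
by apply: measurableT_comp; [exact: measurable_affine1|exact: measurable_tnth].
Qed.


(** By induction on the dimension: an affine map acting coordinate by coordinate
    sends boxes to boxes, and a product measure is determined by its values on boxes. *)
Lemma leb_tuple_affine n (b : n.-tuple M) (A : set (n.-tuple M)) :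
  measurable A ->
  leb_tuple R n (affine_tuple b @^-1` A) = ((a ^- n)%:E * leb_tuple R n A)%E.
Proof.
elim: n b A => [|n IH] b A mA /=.
  rewrite expr0 invr1 mul1e; suff -> : affine_tuple b @^-1` A = A by [].
  have H t : affine_tuple b t = t by rewrite [LHS]tuple0 [RHS]tuple0.
  by apply/seteqP; split => t /=; rewrite H.
pose b' : n.-tuple M := [tuple of behead b].
rewrite /product_image /pushforward.
have an0 : 0 < a ^+ n.+1 by rewrite exprn_gt0.
pose phi (p : M * n.-tuple M) : M * n.-tuple M :=
  (affine1 a (tnth b ord0) p.1, affine_tuple b' p.2).
have mphi : measurable_fun setT phi.
  apply/measurable_fun_pair => /=.
    by apply: measurableT_comp; [exact: measurable_affine1|exact: measurable_fst].
  by apply: measurableT_comp; [exact: measurable_affine_tuple|exact: measurable_snd].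
pose m := mscale (NngNum (ltW an0))
  (pushforward (@lebesgue_measure R \x leb_tuple R n)%E phi).
have -> : (@tcons R n) @^-1` (affine_tuple b @^-1` A) = phi @^-1` (@tcons R n @^-1` A).
  apply/seteqP; suff H : forall p, affine_tuple b (tcons p) = tcons (phi p).
    by split => p /=; rewrite H.
  move=> p; apply/eq_from_tnth => i; rewrite tnth_mktuple.
  case: (unliftP ord0 i) => [j|] -> //=.
  rewrite !tnthS tnth_mktuple; congr affine1.
  by rewrite tnth_behead; congr tnth; apply: val_inj; rewrite /= /inord insubdK// -topredE/= ltnS.
set B := _ @^-1` A.
have mB : measurable B.
  by rewrite -[B]setTI; exact: measurable_tcons.
have -> : (lebesgue_measure \x leb_tuple R n)%E B = m mphi B.
  apply: product_measure_unique => // X Y mX mY.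
  rewrite /m /= /mscale /= /pushforward.
  rewrite (_ : _ @^-1` (X `*` Y) = (affine1 a (tnth b ord0) @^-1` X) `*`
    (affine_tuple b' @^-1` Y)) //.
  rewrite product_measure1E//; last 2 first.
    by rewrite -[X in measurable X]setTI; exact: measurable_affine1.
    by rewrite -[X in measurable X]setTI; exact: measurable_affine_tuple.
  transitivity ((a ^+ n.+1)%:E * ((a^-1%:E * lebesgue_measure X) *
      ((a ^- n)%:E * leb_tuple R n Y)))%E.
    by congr (_ * (_ * _))%E; [exact: lebesgue_measure_affine1|exact: IH].
  apply: mule_factors.
  by rewrite -invfM -exprS divff// gt_eqF.
by rewrite /m /= /mscale /= /pushforward muleA -EFinM mulVf ?gt_eqF// mul1e.
Qed.

End affine_tuple.

(** * The Euclidean norm and the volume of balls *)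

Lemma continuous_bigsum (K : numFieldType) (T : topologicalType)
    (V : normedModType K) (I : Type) (s : seq I) (F : I -> T -> V) :
  (forall i, continuous (F i)) -> continuous (fun x => \sum_(i <- s) F i x).
Proof.
move=> cF; elim: s => [|i s IH] x.
  by rewrite (_ : (fun _ => _) = cst 0)//; [exact: cvg_cst|apply/funext => y; rewrite big_nil].
rewrite (_ : (fun _ => _) = F i \+ (fun x => \sum_(i <- s) F i x)).
  by apply: cvgD; [exact: cF|exact: IH].
by apply/funext => y; rewrite big_cons.
Qed.

Section euclidean_norm.
Context {R : realType} {n : nat}.
Implicit Types x y z : 'rV[R]_n.

Definition dot x y : R := \sum_(i < n) x 0 i * y 0 i.

Lemma dotC x y : dot x y = dot y x.
Proof. by apply: eq_bigr => i _; rewrite mulrC. Qed.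

Lemma dotDl x y z : dot (x + y) z = dot x z + dot y z.
Proof. by rewrite -big_split; apply: eq_bigr => i _; rewrite /= mxE mulrDl. Qed.

Lemma dotZl a x y : dot (a *: x) y = a * dot x y.
Proof. by rewrite mulr_sumr; apply: eq_bigr => i _; rewrite /= mxE mulrA. Qed.

Lemma dot0l y : dot 0 y = 0.
Proof. by rewrite -(scale0r 0) dotZl mul0r. Qed.

Lemma dotNl x y : dot (- x) y = - dot x y.
Proof. by rewrite -scaleN1r dotZl mulN1r. Qed.

Lemma dotBl x y z : dot (x - y) z = dot x z - dot y z.
Proof. by rewrite dotDl dotNl. Qed.

Lemma dotDr x y z : dot z (x + y) = dot z x + dot z y.
Proof. by rewrite dotC dotDl !(dotC z). Qed.

Lemma dotZr a x y : dot y (a *: x) = a * dot y x.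
Proof. by rewrite dotC dotZl (dotC y). Qed.

Lemma dotBr x y z : dot z (x - y) = dot z x - dot z y.
Proof. by rewrite dotC dotBl !(dotC z). Qed.

Lemma enormE x : enorm x = Num.sqrt (dot x x).
Proof. by rewrite /enorm /dot; congr Num.sqrt; apply: eq_bigr => i _; rewrite expr2. Qed.

Lemma dot_ge0 x : 0 <= dot x x.
Proof. by apply: sumr_ge0 => i _; rewrite -expr2 sqr_ge0. Qed.

Lemma enorm_ge0 x : 0 <= enorm x.
Proof. exact: sqrtr_ge0. Qed.

Lemma sqr_enorm x : enorm x ^+ 2 = dot x x.
Proof. by rewrite enormE sqr_sqrtr// dot_ge0. Qed.

Lemma coord_le_enorm x i : `|x 0 i| <= enorm x.
Proof.
rewrite -(@ler_pXn2r _ 2)// ?nnegrE ?enorm_ge0 ?normr_ge0//.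
rewrite sqr_enorm real_normK ?num_real// /dot (bigD1 i)//= -expr2 lerDl.
by apply: sumr_ge0 => j _; rewrite -expr2 sqr_ge0.
Qed.

Lemma enorm_eq0 x : enorm x = 0 -> x = 0.
Proof.
move=> x0; apply/rowP => i; rewrite !mxE; apply/eqP.
by rewrite -normr_le0 -x0 coord_le_enorm.
Qed.

Lemma dot_le x y : dot x y <= enorm x * enorm y.
Proof.
have [/eqP|] := eqVneq (enorm x * enorm y) 0.
  rewrite mulf_eq0 => /orP[] /eqP /enorm_eq0 ->.
    by rewrite dot0l mulr_ge0// enorm_ge0.
  by rewrite dotC dot0l mulr_ge0// enorm_ge0.
move=> xy0; have xy_gt0 : 0 < enorm x * enorm y.
  by rewrite lt_neqAle eq_sym xy0 mulr_ge0// enorm_ge0.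
have := dot_ge0 (enorm y *: x - enorm x *: y).
rewrite !(dotBl, dotBr, dotZl, dotZr) -!sqr_enorm (dotC y x) => H.
by rewrite -(ler_pM2l xy_gt0); nra.
Qed.

Lemma enormD x y : enorm (x + y) <= enorm x + enorm y.
Proof.
rewrite -(@ler_pXn2r _ 2)// ?nnegrE ?addr_ge0 ?enorm_ge0//.
rewrite sqr_enorm dotDl !dotDr -!sqr_enorm (dotC y x).
have := dot_le x y; nra.
Qed.

Lemma enormZ a x : enorm (a *: x) = `|a| * enorm x.
Proof. by rewrite !enormE dotZl dotZr mulrA -expr2 sqrtrM ?sqr_ge0// sqrtr_sqr. Qed.

Lemma enormN x : enorm (- x) = enorm x.
Proof. by rewrite -scaleN1r enormZ normrN1 mul1r. Qed.

Lemma enormB x y : enorm (x - y) = enorm (y - x).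
Proof. by rewrite -enormN opprB. Qed.

Lemma enorm0 : enorm (0 : 'rV[R]_n) = 0.
Proof. by rewrite -(scale0r 0) enormZ normr0 mul0r. Qed.

Lemma norm_le_enorm x : `|x| <= enorm x.
Proof.
rewrite [leLHS]/Num.Def.normr/= mx_normrE (bigmax_le _ (enorm_ge0 x))//.
by move=> [i j] _ /=; rewrite ord1 coord_le_enorm.
Qed.

Lemma coord_le_norm x i : `|x 0 i| <= `|x|.
Proof.
by rewrite [leRHS]/Num.Def.normr/= mx_normrE; apply: (le_bigmax _ _ (0, i)).
Qed.

Lemma enorm_le_norm x : enorm x <= n%:R * `|x|.
Proof.
rewrite -(@ler_pXn2r _ 2)// ?nnegrE ?mulr_ge0 ?enorm_ge0//.
rewrite sqr_enorm /dot exprMn.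
apply: (@le_trans _ _ (\sum_(i < n) `|x| ^+ 2)).
  apply: ler_sum => i _; rewrite -expr2 -real_normK ?num_real//.
  by rewrite lerXn2r ?nnegrE// coord_le_norm.
rewrite sumr_const card_ord -[leLHS]mulr_natl ler_wpM2r ?sqr_ge0//.
by rewrite -natrX ler_nat; case: (n) => // m; rewrite leq_pmull.
Qed.

Lemma enorm_continuous : continuous (@enorm R n).
Proof.
move=> x.
apply: (@continuous_comp _ _ _ (fun y : 'rV[R]_n => \sum_(i < n) y 0 i ^+ 2) Num.sqrt).
  apply: continuous_bigsum => i {}x; apply: (@continuous_comp _ _ _ _ (fun t : R => t ^+ 2)).
    exact: coord_continuous.
  exact: exprn_continuous.
exact: sqrt_continuous.
Qed.

Lemma eball_open x r : open (eball x r).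
Proof.
rewrite (_ : eball x r = (fun y => enorm (y - x)) @^-1` [set t | t < r])//.
apply: open_comp; last exact: open_lt.
move=> y _; apply: (@continuous_comp _ _ _ (fun y => y - x) (@enorm R n)).
  by apply: continuousB; [exact: cvg_id|exact: cst_continuous].
exact: enorm_continuous.
Qed.

End euclidean_norm.

Section lebesgue_row.
Context {R : realType} {n : nat}.
Local Notation leb := (@lebesgue R n).
Implicit Types (A B : set (eucl R n)).

Lemma open_measurable_eucl (A : set 'rV[R]_n) :
  open A -> measurable (A : set (eucl R n)).
Proof. by move=> oA; apply: sub_sigma_algebra. Qed.

Lemma measurable_eball x r : measurable (eball x r : set (eucl R n)).
Proof. by apply: open_measurable_eucl; exact: eball_open. Qed.

Lemma continuous_measurable_eucl (f : 'rV[R]_n -> R) : continuous f ->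
  measurable_fun setT (f : eucl R n -> measurableTypeR R).
Proof.
move=> cf; apply: (measurability _ (RGenOpens.measurableE R)).
move=> _ [_ [a [b ->] <-]]; rewrite setTI; apply: open_measurable_eucl.
by apply: open_comp => [x _|]; [exact: cf|exact: interval_open].
Qed.

Lemma lebesgue_affine (a : R) (b : 'rV[R]_n) A : 0 < a -> measurable A ->
  (leb ((fun y : 'rV[R]_n => a *: y + b)%R @^-1` A) = (a ^- n)%:E * leb A)%E.
Proof.
move=> a0 mA; rewrite /lebesgue /pushforward.
rewrite -(leb_tuple_affine a0 [tuple b 0 i | i < n]); last first.
  by rewrite -[X in measurable X]setTI; exact: measurable_row_of_tuple.
congr (leb_tuple R n _); apply/seteqP.
suff H t : row_of_tuple (affine_tuple a [tuple b 0 i | i < n] t) = a *: row_of_tuple t + b.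
  by split => t /=; rewrite H.
by apply/rowP => i; rewrite !mxE !tnth_mktuple.
Qed.

Lemma measurable_tuple_cube m :
  measurable [set t : m.-tuple (measurableTypeR R) | forall i, -1 <= tnth t i <= 1].
Proof.
rewrite (_ : [set _ | _] = \bigcap_(i in [set: 'I_m])
    ((fun t : m.-tuple (measurableTypeR R) => tnth t i) @^-1` `[-1, 1]%classic)).
  apply: fin_bigcap_measurable => // i _.
  by rewrite -[X in measurable X]setTI; exact: measurable_tnth.
apply/seteqP; split => [t H i _/=|t H i]; first by rewrite in_itv; exact: H.
by have := H i I; rewrite /= in_itv.
Qed.

Lemma leb_tuple_cube_fin m :
  (leb_tuple R m [set t | forall i, -1 <= tnth t i <= 1]%R < +oo)%E.
Proof.
elim: m => [|m IH]; first by rewrite /= diracE ltry.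
rewrite /= /product_image /pushforward.
rewrite (_ : _ @^-1` _ = `[-1, 1]%classic `*`
    [set t : m.-tuple _ | forall i, -1 <= tnth t i <= 1]); last first.
  apply/seteqP; split => [[x t]/= H|[x t]/= [Hx Ht] i].
    split; first by have := H ord0; rewrite in_itv.
    by move=> i; have := H (lift ord0 i); rewrite tnthS.
  case: (unliftP ord0 i) => [j|] ->; last by move: Hx; rewrite in_itv.
  by rewrite tnthS.
have mC := @measurable_tuple_cube m.
rewrite product_measure1E//.
rewrite lte_mul_pinfty//.
suff H : lebesgue_measure (`[-1, 1]%classic : set R) \is a fin_num by exact: H.
by rewrite lebesgue_measure_itv; case: ifP.
Qed.

Lemma leb_tuple_setT_gt0 m : (0 < leb_tuple R m setT)%E.
Proof.
elim: m => [|m IH]; first by rewrite /= diracT lte_fin.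
rewrite /= /product_image /pushforward preimage_setT -setXTT product_measure1E//.
apply: mule_gt0; last exact: IH.
suff H : (0 < lebesgue_measure (setT : set R))%E by exact: H.
have := @lebesgue_measure_itv R `]-oo, +oo[; rewrite set_itvE /= => E.
by have -> : lebesgue_measure (setT : set R) = +oo%E by exact: E.
Qed.

Lemma lebesgue_unit_ball_fin : (leb (eball 0 1) < +oo)%E.
Proof.
apply: le_lt_trans (leb_tuple_cube_fin n); rewrite /lebesgue /pushforward.
apply: le_measure; rewrite ?inE.
- by rewrite -[X in measurable X]setTI; apply: measurable_row_of_tuple => //; exact: measurable_eball.
- exact: measurable_tuple_cube.
- move=> t; rewrite /eball /= subr0 => H i; rewrite -ler_norml.
  have := coord_le_enorm (row_of_tuple t) i; rewrite mxE => /le_trans; apply.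
  exact: ltW.
Qed.

Lemma lebesgue_eball x r : 0 < r -> (leb (eball x r) = (r ^+ n)%:E * leb (eball 0 1))%E.
Proof.
move=> r0; have r1 : 0 < r^-1 by rewrite invr_gt0.
have -> : eball x r = (fun y : 'rV[R]_n => r^-1 *: y + (- (r^-1 *: x))) @^-1` eball 0 1.
  apply/seteqP; split=> y; rewrite /eball /= subr0 -scalerBr enormZ gtr0_norm//;
    by rewrite mulrC ltr_pdivrMr// mul1r.
by rewrite lebesgue_affine//; [rewrite exprVn invrK | exact: measurable_eball].
Qed.

(** Otherwise all balls are negligible by scaling, and so is their union, the whole
    space. *)
Lemma lebesgue_unit_ball_gt0 : (0 < leb (eball 0 1))%E.
Proof.
rewrite lt_neqAle measure_ge0 andbT; apply/eqP => l0.
have := leb_tuple_setT_gt0 n.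
suff : leb setT = 0%E by rewrite /lebesgue /pushforward preimage_setT => ->; rewrite ltxx.
have -> : setT = \bigcup_k eball 0 k.+1%:R :> set (eucl R n).
  apply/esym/seteqP; split => // x _; exists (Num.truncn (enorm x)) => //.
  by rewrite /eball /= subr0 truncnS_gt.
apply/eqP; rewrite eq_le measure_ge0 andbT.
have mF k : measurable (eball 0 k.+1%:R : set (eucl R n)) by exact: measurable_eball.
have := @measure_sigma_subadditive _ _ _ leb _ _ mF (bigcupT_measurable _ mF) (@subset_refl _ _).
move=> /le_trans; apply.
rewrite eseries0// => k _ _; transitivity (leb (eball 0 k.+1%:R)) => //.
by rewrite lebesgue_eball// -l0 mule0.
Qed.

End lebesgue_row.

(** * Continuously differentiable maps and radial cut-offs *)

Lemma continuous_scalel (R : realType) (T : topologicalType)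
  (V : normedModType R) (k : T -> R) (a : V) :
  continuous k -> continuous (fun x => k x *: a).
Proof. by move=> ck x; apply: cvgZr_tmp; exact: ck. Qed.

Lemma continuous_sub (R : realType) (T : topologicalType) (f g : T -> R) :
  continuous f -> continuous g -> continuous (fun x => f x - g x).
Proof. by move=> cf cg x; apply: cvgB; [exact: cf|exact: cg]. Qed.

Lemma continuous_mul (R : realType) (T : topologicalType) (f g : T -> R) :
  continuous f -> continuous g -> continuous (fun x => f x * g x).
Proof. by move=> cf cg x; apply: cvgM; [exact: cf|exact: cg]. Qed.

Section C1_calculus.
Context {R : realType} {V : normedModType R}.

(** Continuity of the differential is asked in each fixed direction, a form that
    sums, products and compositions preserve without any operator norm. *)
Definition C1 {W : normedModType R} (f : V -> W) :=
  (forall x, differentiable f x) /\ forall v, continuous (fun x => 'd f x v).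

Lemma C1_continuous {W : normedModType R} (f : V -> W) : C1 f -> continuous f.
Proof. by move=> [df _] x; exact: differentiable_continuous. Qed.

Lemma C1_cst {W : normedModType R} (a : W) : C1 (fun _ : V => a).
Proof.
split=> [x|v x]; first exact: differentiable_cst.
rewrite (_ : (fun _ => _) = cst 0); first exact: cst_continuous.
by apply/funext => y; rewrite diff_cst.
Qed.

Lemma diffD_at {W : normedModType R} (f g : V -> W) : C1 f -> C1 g ->
  forall x v, 'd (fun x => f x + g x) x v = 'd f x v + 'd g x v.
Proof. by move=> [df _] [dg _] x v; rewrite diffD. Qed.

Lemma C1D {W : normedModType R} (f g : V -> W) : C1 f -> C1 g ->
  C1 (fun x => f x + g x).
Proof.
move=> Cf Cg; split=> [x|v].
  by apply: differentiableD; [exact: Cf.1|exact: Cg.1].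
under eq_fun do rewrite diffD_at//.
by move=> x; apply: cvgD; [exact: Cf.2|exact: Cg.2].
Qed.

Lemma diffN_at {W : normedModType R} (f : V -> W) : C1 f ->
  forall x v, 'd (fun x => - f x) x v = - 'd f x v.
Proof. by move=> [df _] x v; rewrite diffN. Qed.

Lemma C1N {W : normedModType R} (f : V -> W) : C1 f -> C1 (fun x => - f x).
Proof.
move=> Cf; split=> [x|v]; first by apply: differentiableN; exact: Cf.1.
under eq_fun do rewrite diffN_at//.
by move=> x; apply: cvgN; exact: Cf.2.
Qed.

Lemma diffB_at {W : normedModType R} (f g : V -> W) : C1 f -> C1 g ->
  forall x v, 'd (fun x => f x - g x) x v = 'd f x v - 'd g x v.
Proof.
by move=> Cf Cg x v; rewrite (diffD_at Cf (C1N Cg)) (diffN_at Cg).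
Qed.

Lemma C1B {W : normedModType R} (f g : V -> W) : C1 f -> C1 g ->
  C1 (fun x => f x - g x).
Proof. by move=> Cf Cg; exact: (C1D Cf (C1N Cg)). Qed.

Lemma diffM_at (f g : V -> R) : C1 f -> C1 g -> forall x v,
  'd (fun x => f x * g x) x v = f x * 'd g x v + g x * 'd f x v.
Proof. by move=> [df _] [dg _] x v; rewrite diffM. Qed.

Lemma C1M (f g : V -> R) : C1 f -> C1 g -> C1 (fun x => f x * g x).
Proof.
move=> Cf Cg; split=> [x|v].
  by apply: differentiableM; [exact: Cf.1|exact: Cg.1].
under eq_fun do rewrite diffM_at//.
move=> x; apply: cvgD; apply: cvgM.
- exact: (C1_continuous Cf).
- exact: Cg.2.
- exact: (C1_continuous Cg).
- exact: Cf.2.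
Qed.

Lemma diff_comp_at (phi dphi : R -> R) (f : V -> R) :
  (forall t : R, is_derive t 1 phi (dphi t)) -> C1 f ->
  forall x v, 'd (fun x => phi (f x)) x v = dphi (f x) * 'd f x v.
Proof.
move=> dp [df _] x v.
have pd : derivable phi (f x) 1 by have [] := dp (f x).
rewrite (@diff_comp _ _ _ _ f phi)//; last exact/derivable1_diffP.
rewrite /= deriv1E// mulrC derive1E; congr (_ * _).
by have [_ ->] := dp (f x).
Qed.

Lemma C1_comp (phi dphi : R -> R) (f : V -> R) :
  (forall t : R, is_derive t 1 phi (dphi t)) -> continuous dphi -> C1 f ->
  C1 (fun x => phi (f x)).
Proof.
move=> dp cp Cf; split=> [x|v].
  apply: (@differentiable_comp _ _ _ _ f phi); first exact: Cf.1.
  by apply/derivable1_diffP; have [] := dp (f x).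
under eq_fun do rewrite (diff_comp_at dp)//.
move=> x; apply: cvgM; last exact: Cf.2.
by apply: (@continuous_comp _ _ _ f dphi); [exact: (C1_continuous Cf)|exact: cp].
Qed.

End C1_calculus.

Section C1_rows.
Context {R : realType} {V : normedModType R} {n : nat}.
Implicit Types (S : V -> 'rV[R]_n).

Lemma diff_coord S : C1 S ->
  forall x v i, 'd (fun x => S x 0 i) x v = 'd S x v 0 i.
Proof.
move=> [dS _] x v i.
rewrite -!deriveE//.
  by rewrite derive_mx ?mxE//; exact: diff_derivable.
by apply: (@differentiable_comp _ _ _ _ S (fun N : 'rV_n => N 0 i)) => //; exact: differentiable_coord.
Qed.

Lemma C1_coord S i : C1 S -> C1 (fun x => S x 0 i).
Proof.
move=> CS; split=> [x|v].
  by apply: (@differentiable_comp _ _ _ _ S (fun N : 'rV_n => N 0 i)) => //;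
    [exact: CS.1|exact: differentiable_coord].
under eq_fun do rewrite diff_coord//.
move=> x; apply: (@continuous_comp _ _ _ (fun x => 'd S x v) (fun N : 'rV_n => N 0 i)).
  exact: CS.2.
exact: coord_continuous.
Qed.

(** A row vector is the sum of its coordinates times the canonical basis, so C1
    regularity of fields reduces to that of functions, e.g. for products below. *)
Lemma C1_row S : (forall i, C1 (fun x => S x 0 i)) -> C1 S.
Proof.
move=> CS.
have dS x : differentiable S x.
  have -> : S = \sum_(i < n) (fun x => S x 0 i *: (delta_mx 0 i : 'rV[R]_n)).
    apply/funext => y; rewrite fct_sumE [LHS]row_sum_delta.
    by apply: eq_bigr.
  by apply: differentiable_sum => i; apply: differentiableZl; exact: (CS i).1.
split=> // v.
have -> : (fun x => 'd S x v) =
    fun x => \sum_(i < n) 'd (fun x => S x 0 i) x v *: (delta_mx 0 i : 'rV[R]_n).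
  apply/funext => x; rewrite [LHS]row_sum_delta; apply: eq_bigr => i _.
  congr (_ *: _).
  rewrite -!deriveE//; last exact: (CS i).1.
  by rewrite derive_mx ?mxE//; exact: diff_derivable.
by apply: continuous_bigsum => i; apply: continuous_scalel; exact: (CS i).2.
Qed.

Lemma C1Z (u : V -> R) S : C1 u -> C1 S -> C1 (fun x => u x *: S x).
Proof.
move=> Cu CS; apply: C1_row => i.
under eq_fun do rewrite mxE.
exact: (C1M Cu (C1_coord i CS)).
Qed.

Lemma diffZ_coord (u : V -> R) S : C1 u -> C1 S -> forall x v i,
  'd (fun x => u x *: S x) x v 0 i = u x * 'd S x v 0 i + S x 0 i * 'd u x v.
Proof.
move=> Cu CS x v i; apply: (etrans (esym (diff_coord (C1Z Cu CS) x v i))).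
have -> : (fun z => (u z *: S z) 0 i) = fun z => u z * S z 0 i.
  by apply/funext => z; rewrite mxE.
apply: (etrans (diffM_at Cu (C1_coord i CS) x v)).
by congr (_ * _ + _); exact: (diff_coord CS).
Qed.

End C1_rows.

Section fields.
Context {R : realType} {n : nat}.
Implicit Types (S T : 'rV[R]_n -> 'rV[R]_n) (x y v : 'rV[R]_n).

Lemma C1_id : C1 (id : 'rV[R]_n -> 'rV[R]_n).
Proof.
split=> [x|v]; first by have [] := @is_diff_id R 'rV[R]_n x.
rewrite (_ : (fun _ => _) = cst v); first exact: cst_continuous.
by apply/funext => x; have [_ ->] := @is_diff_id R 'rV[R]_n x.
Qed.

Lemma divergenceE S x : divergence S x = \sum_(i < n) 'd S x (delta_mx 0 i) 0 i.
Proof.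
by rewrite /divergence /mxtrace; apply: eq_bigr => i _; rewrite /jacobian !mxE.
Qed.

Lemma divergenceD S T : C1 S -> C1 T ->
  forall x, divergence (fun x => S x + T x) x = divergence S x + divergence T x.
Proof.
move=> CS CT x; rewrite !divergenceE -big_split; apply: eq_bigr => i _ /=.
exact: etrans (congr1 (fun w : 'rV_n => w 0 i) (diffD_at CS CT x _)) (mxE _ _ _ _).
Qed.

Lemma divergenceB S T : C1 S -> C1 T ->
  forall x, divergence (fun x => S x - T x) x = divergence S x - divergence T x.
Proof.
move=> CS CT x; rewrite !divergenceE -sumrB; apply: eq_bigr => i _ /=.
apply: (etrans (congr1 (fun w : 'rV_n => w 0 i) (diffB_at CS CT x _))).
by rewrite !mxE.
Qed.

Lemma divergence_id x : divergence id x = n%:R.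
Proof.
rewrite divergenceE (eq_bigr (fun=> 1)) ?sumr_const ?card_ord// => i _.
by have [_ ->] := @is_diff_id R 'rV[R]_n x; rewrite mxE !eqxx.
Qed.

Lemma diff_coord_continuous S v (i : 'I_n) : C1 S ->
  continuous (fun x => 'd S x v 0 i).
Proof.
move=> CS x.
apply: (@continuous_comp _ _ _ (fun x => 'd S x v) (fun N : 'rV_n => N 0 i)).
  exact: CS.2.
exact: coord_continuous.
Qed.

Lemma divergence_continuous S : C1 S -> continuous (divergence S).
Proof.
move=> CS; rewrite (funext (divergenceE S)).
by apply: continuous_bigsum => i; exact: diff_coord_continuous.
Qed.

Lemma C1_jacobian S : C1 S <-> (forall x, differentiable S x) /\ continuous (jacobian S).
Proof.
split=> [CS|[dS cJ]]; split=> //; try exact: CS.1.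
  have -> : jacobian S = fun x => \sum_(i < n) \sum_(j < n)
     'd S x (delta_mx 0 i) 0 j *: (delta_mx i j : 'M[R]_n).
    apply/funext => x; rewrite [LHS]matrix_sum_delta.
    by apply: eq_bigr => i _; apply: eq_bigr => j _; rewrite /jacobian mxE.
  apply: continuous_bigsum => i; apply: continuous_bigsum => j.
  exact/continuous_scalel/diff_coord_continuous.
move=> v.
have -> : (fun x => 'd S x v) = fun x => \sum_(j < n) (\sum_(i < n)
     v 0 i * jacobian S x i j) *: (delta_mx 0 j : 'rV[R]_n).
  apply/funext => x; rewrite -deriveE// deriveEjacobian// [LHS]row_sum_delta.
  by apply: eq_bigr => j _; rewrite mxE.
apply: continuous_bigsum => j; apply: continuous_scalel.
apply: continuous_bigsum => i; apply: continuous_mul; first exact: cst_continuous.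
move=> x; have /(_ x) := @continuous_comp _ _ _ (jacobian S) (fun N : 'M[R]_n => N i j).
by apply; [exact: cJ|exact: coord_continuous].
Qed.

Definition sqdist y x : R := dot (x - y) (x - y).

Lemma sqdistE y x : sqdist y x = enorm (x - y) ^+ 2.
Proof. by rewrite sqr_enorm. Qed.

Lemma C1_sqdist y : C1 (sqdist y).
Proof.
have C i : C1 (fun x => (x - y) 0 i).
  exact: (C1_coord i (C1B C1_id (C1_cst y))).
rewrite /sqdist /dot.
elim: (index_enum _) => [|i s IH].
  by under eq_fun do rewrite big_nil; exact: C1_cst.
by under eq_fun do rewrite big_cons; exact: (C1D (C1M (C i) (C i)) IH).
Qed.

Lemma diff_sqdist y x v : 'd (sqdist y) x v = 2 * dot (x - y) v.
Proof.
have CB : C1 (fun x => x - y) by exact: (C1B C1_id (C1_cst y)).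
have C i : C1 (fun x => (x - y) 0 i).
  exact: (C1_coord i CB).
have dC i : 'd (fun x => (x - y) 0 i) x v = v 0 i.
  apply: (etrans (diff_coord CB x v i)).
  have E1 : 'd (id : 'rV[R]_n -> 'rV[R]_n) x v = v.
    by have [_ ->] := @is_diff_id R 'rV[R]_n x.
  have E2 : 'd (fun _ : 'rV[R]_n => y) x v = 0 by rewrite diff_cst.
  apply: (etrans (congr1 (fun w : 'rV_n => w 0 i) (diffB_at C1_id (C1_cst y) x v))).
  by rewrite mxE [in X in X + _]E1 mxE [in X in _ - X]E2 mxE subr0.
suff [] : C1 (sqdist y) /\ 'd (sqdist y) x v = 2 * dot (x - y) v by [].
rewrite /sqdist /dot.
elim: (index_enum _) => [|i s [IH1 IH2]].
  under eq_fun do rewrite big_nil; rewrite big_nil mulr0 diff_cst; split=> //.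
  exact: C1_cst.
under eq_fun do rewrite big_cons; split; first exact: (C1D (C1M (C i) (C i)) IH1).
rewrite (diffD_at (C1M (C i) (C i)) IH1) IH2 big_cons mulrDr; congr (_ + _).
by rewrite (diffM_at (C i) (C i)) dC; ring.
Qed.

(** The gradient of a radial factor phi(|x - y|^2) is 2 phi' (x - y), so only the
    radial component of the field sees it. *)
Lemma divergence_radial (phi dphi : R -> R) y S :
  (forall t : R, is_derive t 1 phi (dphi t)) -> continuous dphi -> C1 S ->
  forall x, divergence (fun x => phi (sqdist y x) *: S x) x =
    phi (sqdist y x) * divergence S x + 2 * dphi (sqdist y x) * dot (x - y) (S x).
Proof.
move=> dp cp CS x.
have Cp : C1 (fun x => phi (sqdist y x)) by exact: (C1_comp dp cp (C1_sqdist y)).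
rewrite !divergenceE mulr_sumr /dot mulr_sumr -big_split; apply: eq_bigr => i _ /=.
apply: (etrans (diffZ_coord Cp CS x _ i)); congr (_ + _).
have -> : 'd (fun x => phi (sqdist y x)) x 'e_i =
    dphi (sqdist y x) * (2 * (x - y) 0 i).
  apply: (etrans (diff_comp_at dp (C1_sqdist y) x _)); congr (_ * _).
  apply: (etrans (diff_sqdist y x _)); congr (_ * _).
  rewrite /dot (bigD1 i)//= big1 ?addr0 => [|j ji].
    by rewrite [delta_mx 0 i 0 i]mxE !eqxx mulr1.
  by rewrite [delta_mx 0 i 0 j]mxE (negbTE ji) andbF mulr0.
by ring.
Qed.

End fields.

Section cutoff_profiles.
Context {R : realType}.
Implicit Types s t : R.

(** Serves max(t, 0)^2 at its kink, where no differentiation rule applies. *)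
Lemma is_derive_quadratic (phi : R -> R) t d C :
  (forall h, `|phi (t + h) - phi t - d * h| <= C * h ^+ 2) ->
  is_derive t 1 phi d.
Proof.
move=> H; have C0 : 0 <= C by have := H 1; have := normr_ge0 (phi (t + 1) - phi t - d * 1); lra.
suff cv : (fun h => h^-1 *: ((phi \o shift t) (h *: (1 : R)) - phi t)) @ 0^' --> d.
  by split; [apply/cvg_ex; exists d|exact/cvg_lim].
apply/cvgrPdist_le => e e0; near=> h.
have h0 : h != 0 by near: h; exact: nbhs_dnbhs_neq.
have he : `|h| <= e / (C + 1).
  by near: h; apply: dnbhs0_le; rewrite divr_gt0// ltr_wpDl.
rewrite /= /shift /= [h *: 1]mulr1 [h + t]addrC.
have aux (u a b c : R) : u != 0 -> c - u^-1 * (a - b) = - (u^-1 * (a - b - c * u)).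
  by move=> u0; field.
rewrite [X in `|X|](_ : _ = - (h^-1 * (phi (t + h) - phi t - d * h))); last exact: aux.
rewrite normrN normrM normfV ler_pdivrMl ?normr_gt0//.
apply: (le_trans (H h)).
rewrite -(real_normK (num_real h)).
have a0 := normr_ge0 h; move: he; rewrite ler_pdivlMr ?ltr_wpDl// => he.
nra.
Unshelve. all: by end_near. Qed.

Definition pos2 t : R := Num.max t 0 ^+ 2.

Lemma is_derive_pos2 t : is_derive t 1 pos2 (2 * Num.max t 0).
Proof.
apply: (@is_derive_quadratic _ _ _ 1) => h; rewrite /pos2 mul1r ler_norml.
by case: (ltP t 0) => ?; case: (ltP (t + h) 0) => ?; apply/andP; split; nra.
Qed.

Lemma pos2_ge0 t : 0 <= pos2 t. Proof. exact: sqr_ge0. Qed.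

Lemma pos2_eq0 t : t <= 0 -> pos2 t = 0.
Proof. by move=> t0; rewrite /pos2 max_r// expr0n. Qed.

Lemma pos2E t : 0 <= t -> pos2 t = t ^+ 2.
Proof. by move=> t0; rewrite /pos2 max_l. Qed.

Lemma pos_continuous : continuous (fun t : R => Num.max t 0).
Proof.
by move=> t; apply: continuous_max; [exact: cvg_id|exact: cst_continuous].
Qed.

(** A nonincreasing profile equal to 1 for s <= c - 1/k and to 0 for s >= c, of
    class C1 as a composition of positive parts squared. *)
Definition step (k c s : R) : R := pos2 (1 - pos2 (1 - k * (c - s))).

Definition dstep (k c s : R) : R :=
  - (2 * Num.max (1 - pos2 (1 - k * (c - s))) 0 * (2 * Num.max (1 - k * (c - s)) 0 * k)).

Lemma is_derive_step k c s : is_derive s 1 (step k c) (dstep k c s).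
Proof.
have d1 : is_derive s 1 (fun s => 1 - k * (c - s)) k.
  apply: (@is_derive_quadratic _ _ _ 0) => h; rewrite mul0r.
  by rewrite (_ : _ - _ = 0) ?normr0//; ring.
have d2 : is_derive s 1 (fun s => 1 - pos2 (1 - k * (c - s)))
    (- (2 * Num.max (1 - k * (c - s)) 0 * k)).
  rewrite -[X in is_derive _ _ _ X]add0r; apply: is_deriveB.
  exact: (@is_derive1_comp _ pos2 (fun s => 1 - k * (c - s)) s _ _ (is_derive_pos2 _) d1).
rewrite /dstep -mulrN.
exact: (@is_derive1_comp _ pos2 (fun s => 1 - pos2 (1 - k * (c - s))) s _ _ (is_derive_pos2 _) d2).
Qed.

Lemma dstep_continuous k c : continuous (dstep k c).
Proof.
have c1 : continuous (fun s : R => 1 - k * (c - s)).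
  move=> s; apply: cvgB; first exact: cvg_cst.
  apply: cvgM; first exact: cvg_cst.
  by apply: cvgB; [exact: cvg_cst|exact: cvg_id].
have c2 : continuous (fun s : R => Num.max (1 - k * (c - s)) 0).
  move=> s; apply: (@continuous_comp _ _ _ (fun s : R => 1 - k * (c - s)) (fun t : R => Num.max t 0)).
    exact: c1.
  exact: pos_continuous.
have c3 : continuous (fun s : R => 1 - pos2 (1 - k * (c - s))).
  move=> s; apply: cvgB; first exact: cvg_cst.
  by rewrite /pos2; under eq_fun do rewrite expr2; apply: cvgM; exact: c2.
move=> s; apply: cvgN; apply: cvgM; apply: cvgM; try exact: cvg_cst.
  apply: (@continuous_comp _ _ _ (fun s : R => 1 - pos2 (1 - k * (c - s))) (fun t : R => Num.max t 0)).
    exact: c3.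
  exact: pos_continuous.
by apply: cvgM; [exact: cvg_cst|exact: c2].
Qed.

Lemma step_ge0 k c s : 0 <= step k c s. Proof. exact: pos2_ge0. Qed.

Lemma step_le1 k c s : step k c s <= 1.
Proof.
rewrite /step; have := pos2_ge0 (1 - k * (c - s)); set v := pos2 _ => v0.
have [v1|v1] := leP v 1.
  by rewrite pos2E ?subr_ge0//; nra.
by rewrite pos2_eq0// subr_le0 ltW.
Qed.

Lemma pos2_ge1 k c s : 0 <= k -> c <= s -> 1 <= pos2 (1 - k * (c - s)).
Proof.
move=> k0 cs; have : k * (c - s) <= 0 by rewrite mulr_ge0_le0// subr_le0.
by move=> K; rewrite pos2E; nra.
Qed.

Lemma step_eq0 k c s : 0 <= k -> c <= s -> step k c s = 0.
Proof.
by move=> k0 cs; rewrite /step pos2_eq0// subr_le0 pos2_ge1.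
Qed.

Lemma step_eq1 k c s : 1 <= k * (c - s) -> step k c s = 1.
Proof.
move=> kcs; rewrite /step (@pos2_eq0 (1 - k * (c - s))) ?subr_le0//.
by rewrite subr0 pos2E ?expr1n.
Qed.

Lemma dstep_eq0l k c s : 1 <= k * (c - s) -> dstep k c s = 0.
Proof.
by move=> kcs; rewrite /dstep (@max_r _ _ (1 - k * (c - s))) ?subr_le0//; ring.
Qed.

Lemma dstep_eq0r k c s : 0 <= k -> c <= s -> dstep k c s = 0.
Proof.
move=> k0 cs; rewrite /dstep (@max_r _ _ (1 - pos2 _)); first by ring.
by rewrite subr_le0 pos2_ge1.
Qed.

Lemma dstep_le0 k c s : 0 <= k -> dstep k c s <= 0.
Proof.
by move=> k0; rewrite /dstep oppr_le0 !mulr_ge0// le_max lexx orbT.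
Qed.

Lemma dstep_ge k c s : 0 <= k -> - (4 * k) <= dstep k c s.
Proof.
move=> k0; have [cs|cs] := leP c s.
  by rewrite dstep_eq0r// oppr_le0 mulr_ge0.
rewrite /dstep lerN2.
set a := Num.max _ _; set b := Num.max _ _.
have a1 : 0 <= a <= 1.
  rewrite le_max lexx orbT ge_max ler01 andbT /=.
  by have := pos2_ge0 (1 - k * (c - s)); lra.
have b1 : 0 <= b <= 1.
  rewrite le_max lexx orbT ge_max ler01 andbT /=.
  have : 0 <= k * (c - s) by rewrite mulr_ge0// subr_ge0 ltW.
  by lra.
have ab1 : a * b <= 1 by rewrite mulr_ile1//; case/andP: a1; case/andP: b1.
nra.
Qed.

End cutoff_profiles.

(** * Integrals of derivatives *)

Section bounded_support.
Context {R : realType} {n : nat}.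
Local Notation leb := (@lebesgue R n).
Implicit Types (u : 'rV[R]_n -> R) (M : R) (A : set (eucl R n)).

Definition supported_in M u := forall x, M < `|x| -> u x = 0.

Definition cube M : set (eucl R n) := [set x : 'rV[R]_n | `|x| <= M].

Lemma cube_closed M : closed (cube M : set 'rV[R]_n).
Proof.
rewrite (_ : cube M = (fun x : 'rV[R]_n => `|x|) @^-1` [set t | t <= M])//.
by apply: closed_comp => [x _|]; [exact: norm_continuous|exact: closed_le].
Qed.

Lemma cube_compact M : compact (cube M : set 'rV[R]_n).
Proof.
apply: bounded_closed_compact; last exact: cube_closed.
exists M; split; first exact: num_real.
by move=> N MN x /= xM; apply: le_trans xM _; exact: ltW.
Qed.

Lemma measurable_cube M : measurable (cube M).
Proof.
rewrite -[cube M]setCK; apply: measurableC; apply: open_measurable_eucl.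
by apply: closed_openC; exact: cube_closed.
Qed.

Lemma cube_fin M : (leb (cube M) < +oo)%E.
Proof.
pose r := n%:R * `|M| + 1; have r0 : 0 < r by rewrite ltr_wpDl// mulr_ge0.
apply: (@le_lt_trans _ _ (leb (eball 0 r))).
  apply: le_measure; rewrite ?inE; [exact: measurable_cube|exact: measurable_eball|].
  move=> x /= xM; rewrite /eball /= subr0; apply: (le_lt_trans (enorm_le_norm x)).
  rewrite ltr_pwDr// ler_wpM2l//; apply: le_trans xM _; exact: ler_norm.
rewrite lebesgue_eball//; apply: lte_mul_pinfty => //.
  by rewrite lee_fin exprn_ge0// ltW.
exact: lebesgue_unit_ball_fin.
Qed.

Lemma integrable_scale_indic (K : R) A : measurable A -> (leb A < +oo)%E ->
  leb.-integrable setT (EFin \o fun x => K * \1_A x).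
Proof.
move=> mA fA.
rewrite (_ : EFin \o _ = (EFin \o cst K) \_ A); last first.
  by apply/funext => x; rewrite patchE /= indicE; case: ifP; rewrite ?mulr1 ?mulr0.
apply/(integrable_mkcond _ mA); apply: measurable_bounded_integrable => //.
exists `|K|; split; first exact: num_real.
by move=> L KL x _ /=; exact: ltW.
Qed.

Lemma bounded_on_cube u M : continuous u ->
  exists2 K, 0 <= K & forall x, `|x| <= M -> `|u x| <= K.
Proof.
move=> cu; have [M0|M0] := ltP M 0.
  by exists 0 => // x xM; have := le_lt_trans xM M0; rewrite normr_lt0.
have nz : cube M !=set0 by exists 0; rewrite /cube /= normr0.
have cn : {within cube M, continuous (fun x => `|u x|)}.
  apply: continuous_subspaceT => x.
  by apply: (@continuous_comp _ _ _ u (fun t => `|t|)); [exact: cu|exact: norm_continuous].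
have [c _ Hc] := EVT_max_rV nz (@cube_compact M) cn.
by exists `|u c| => // x xM; apply: Hc; rewrite inE.
Qed.

Lemma supported_bounded u M : continuous u -> supported_in M u ->
  exists2 K, 0 <= K & forall x, `|u x| <= K.
Proof.
move=> cu su; have [K K0 HK] := @bounded_on_cube u M cu.
exists K => // x; have [|xM] := leP `|x| M; first exact: HK.
by rewrite su// normr0.
Qed.

Lemma supported_integrable u M A : continuous u -> supported_in M u ->
  measurable A -> leb.-integrable A (EFin \o u).
Proof.
move=> cu su mA; have [K K0 uK] := supported_bounded cu su.
apply: (@integrableS _ _ _ _ setT) => //.
have <- : (EFin \o u) \_ (cube M) = EFin \o u.
  apply/funext => x; rewrite patchE; case: ifPn => //.
  by rewrite notin_setE /cube /= => /negP; rewrite -ltNge => /su ->.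
apply/(integrable_mkcond _ (measurable_cube M)).
apply: measurable_bounded_integrable => //.
- exact: measurable_cube.
- exact: cube_fin.
- by apply: measurable_funTS; exact: continuous_measurable_eucl.
- exists K; split; first exact: num_real.
  by move=> L KL x _ /=; apply: le_trans (uK x) _; exact: ltW.
Qed.

Lemma continuous_shift u (w : 'rV[R]_n) : continuous u ->
  continuous (fun x : 'rV[R]_n => u (x + w)).
Proof.
move=> cu x; apply: (@continuous_comp _ _ _ (fun x : 'rV[R]_n => x + w) u); last exact: cu.
by apply: continuousD; [exact: cvg_id|exact: cst_continuous].
Qed.

Lemma Rintegral_translation u M (w : 'rV[R]_n) : continuous u -> supported_in M u ->
  \int[leb]_(x in setT) u (x + w) = \int[leb]_(x in setT) u x.
Proof.
move=> cu su; rewrite /Rintegral; congr fine.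
pose phi : eucl R n -> eucl R n := fun x : 'rV[R]_n => x + w.
have mphi : measurable_fun setT phi.
  apply: (measurability _ (erefl (@measurable _ (eucl R n)))).
  move=> _ [U oU <-]; rewrite setTI; apply: open_measurable_eucl.
  apply: open_comp => // x _; apply: continuousD; [exact: cvg_id|exact: cst_continuous].
have cuw := @continuous_shift u w cu.
have suw : supported_in (M + `|w|) (fun x : 'rV[R]_n => u (x + w)).
  move=> x xM; apply: su; have := ler_normB (x + w) w; rewrite addrK; lra.
have mu : measurable_fun setT (EFin \o u : eucl R n -> _).
  by apply/measurable_EFinP; exact: continuous_measurable_eucl.
transitivity (\int[leb]_(x in phi @^-1` setT) ((EFin \o u) \o phi) x)%E => //.
have ip : leb.-integrable (phi @^-1` setT) ((EFin \o u) \o phi).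
  by rewrite preimage_setT; exact: (supported_integrable cuw suw measurableT).
rewrite -(integral_pushforward mphi mu ip)//.
apply: eq_measure_integral => A mA _; rewrite /pushforward.
have := lebesgue_affine w ltr01 mA; rewrite expr1n invr1 mul1e => /(etrans _); apply.
by congr (leb _); apply/seteqP; split=> x /=; rewrite scale1r.
Qed.

End bounded_support.

Section vanishing_integral.
Context {R : realType} {n : nat}.
Local Notation leb := (@lebesgue R n).
Implicit Types (u : 'rV[R]_n -> R) (M : R).

Lemma diff_supported (W : normedModType R) (f : 'rV[R]_n -> W) M :
  (forall x, differentiable f x) -> (forall x, M < `|x| -> f x = 0) ->
  forall x v, M < `|x| -> 'd f x v = 0.
Proof.
move=> df sf x v xM; rewrite -deriveE//.
rewrite (@near_eq_derive _ _ _ f (cst 0)) ?derive_cst//.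
have : nbhs x [set y : 'rV[R]_n | M < `|y|].
  apply: open_nbhs_nbhs; split => //.
  rewrite (_ : [set y | _] = (fun y : 'rV[R]_n => `|y|) @^-1` [set t | M < t])//.
  by apply: open_comp => [y _|]; [exact: norm_continuous|exact: open_gt].
by apply: filterS => y /sf.
Qed.

Lemma derive_line u (x v : 'rV[R]_n) (t : R) : (forall x, differentiable u x) ->
  is_derive (t : R) 1 (fun t : R => u (x + t *: v)) ('d u (x + t *: v) v).
Proof.
move=> du.
have [D1 D2] := derivableP (@diff_derivable _ _ _ _ _ v (du (x + t *: v))).
have E : (fun h => h^-1 *: (((fun t : R => u (x + t *: v)) \o shift t) (h *: (1 : R)) - u (x + t *: v)))
   = (fun h => h^-1 *: ((u \o shift (x + t *: v)) (h *: v) - u (x + t *: v))).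
  apply/funext => h /=; congr (_ *: (u _ - _)).
  by rewrite /shift /= [h *: 1]mulr1 scalerDl addrCA.
have <- : 'D_v u (x + t *: v) = 'd u (x + t *: v) v by exact: deriveE.
split; first by rewrite /derivable E; exact: D1.
by rewrite /derive E.
Qed.

(** By translation invariance the integral of u(x + t v) does not depend on t;
    differentiate under the integral sign at t = 0. *)
Lemma Rintegral_diff0 u M v : C1 u -> supported_in M u ->
  \int[leb]_x 'd u x v = 0.
Proof.
move=> Cu su; have cu := C1_continuous Cu.
have cD : continuous (fun x => 'd u x v) by exact: Cu.2.
have sD : supported_in M (fun x => 'd u x v).
  by move=> x xM; exact: (diff_supported Cu.1 su).
have [K K0 DK] := supported_bounded cD sD.
pose f (t : R) (x : eucl R n) : R := u ((x : 'rV[R]_n) + t *: v).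
pose G (x : eucl R n) : R := K * \1_(cube (M + `|v|)) x.
have mf t : leb.-integrable setT (EFin \o f t).
  apply: (@supported_integrable _ _ _ (M + `|t *: v|)) => //.
    exact: continuous_shift.
  move=> x xM; apply: su; have := ler_normB ((x : 'rV_n) + t *: v) (t *: v); rewrite addrK; lra.
have d1 t x : (partial1of2 f) t x = 'd u ((x : 'rV[R]_n) + t *: v) v.
  rewrite partial1of2E; have [_ <-] := derive_line x v t Cu.1; by [].
have H := @cvg_differentiation_under_integral R _ (eucl R n) leb f setT measurableT
   0 (-1) 1 _ _ _ G _ _ _.
have {}H : h^-1 *: (\int[leb]_x f (h + 0) x - \int[leb]_x f 0 x) @[h --> 0^'] -->
    \int[leb]_x 'd u x v.
  suff -> : \int[leb]_x 'd u x v = \int[leb]_(y in setT) (partial1of2 f) 0 y.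
    apply: H.
    - by rewrite /= in_itv/= ltrN10 ltr01.
    - by move=> t _.
    - by move=> t x _ _; have [] := derive_line x v t Cu.1.
    - by move=> x; rewrite /G mulr_ge0.
    - by apply: integrable_scale_indic; [exact: measurable_cube|exact: cube_fin].
    - move=> t x; rewrite /= in_itv/= => /andP[t1 t2] _; rewrite d1 /G indicE.
      have [xM|xM] := boolP (x \in _); first by rewrite mulr1.
      rewrite mulr0 sD ?normr0//.
      move: xM; rewrite notin_setE /cube /= => /negP; rewrite -ltNge => xM.
      have := ler_normB ((x : 'rV_n) + t *: v) (t *: v); rewrite addrK normrZ.
      have : `|t| * `|v| <= `|v| by rewrite ler_piMl// ler_norml (ltW t1) ltW.
      lra.
  by apply: eq_Rintegral => x _; rewrite d1 scale0r addr0.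
have E t : \int[leb]_x f t x = \int[leb]_x u x.
  exact: (Rintegral_translation _ cu su).
move: H; under eq_fun do rewrite !E subrr scaler0.
by move=> /(cvg_unique _ (cvg_cst 0)) <-.
Qed.

Lemma Rintegral_divergence0 (S : 'rV[R]_n -> 'rV[R]_n) M :
  C1 S -> (forall x, M < `|x| -> S x = 0) -> \int[leb]_x divergence S x = 0.
Proof.
move=> CS sS.
have Ci i : C1 (fun x => S x 0 i) := C1_coord i CS.
have si i : supported_in M (fun x => S x 0 i) by move=> x /sS ->; rewrite mxE.
rewrite (funext (divergenceE S)).
have I s : leb.-integrable setT (EFin \o fun x : eucl R n =>
      \sum_(i <- s) 'd S x (delta_mx 0 i) 0 i) /\
    \int[leb]_x (\sum_(i <- s) 'd S x (delta_mx 0 i) 0 i) = 0.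
  elim: s => [|i s [IH1 IH2]].
    under eq_fun do rewrite big_nil; split; first exact: integrable0.
    by rewrite Rintegral_cst// mul0r.
  have Ii : leb.-integrable setT (EFin \o (fun x : eucl R n => 'd S x (delta_mx 0 i) 0 i)).
    apply: (@supported_integrable _ _ _ M) => //; first exact: diff_coord_continuous.
    by move=> x xM; rewrite (diff_supported CS.1 sS)// mxE.
  split.
    rewrite (_ : _ \o _ = (EFin \o (fun x : eucl R n => 'd S x (delta_mx 0 i) 0 i)) \+
      (EFin \o fun x : eucl R n => \sum_(i <- s) 'd S x (delta_mx 0 i) 0 i)).
      exact: integrableD.
    by apply/funext => x /=; rewrite big_cons.
  under eq_Rintegral do rewrite big_cons.
  rewrite RintegralD// IH2 addr0.
  rewrite -[RHS](Rintegral_diff0 (delta_mx 0 i) (Ci i) (si i)).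
  by apply: eq_Rintegral => x _; exact/esym/(diff_coord CS).
by have [_] := I (index_enum _).
Qed.

End vanishing_integral.

(** * The divergence theorem on a ball *)

Section fields_integrals.
Context {R : realType} {n : nat}.
Local Notation leb := (@lebesgue R n).
Implicit Types (S T W : 'rV[R]_n -> 'rV[R]_n) (x y : 'rV[R]_n) (A B E F : set (eucl R n)).

Definition field_supported_in (M : R) S := forall x, M < `|x| -> S x = 0.

Lemma divergence_supported M S : C1 S -> field_supported_in M S ->
  supported_in M (divergence S).
Proof.
move=> CS sS x xM; rewrite (divergenceE S x) big1// => i _.
have -> : 'd S x 'e_i = 0 by exact: (diff_supported CS.1 sS).
by rewrite mxE.
Qed.

Lemma divergence_integrable M S A : C1 S -> field_supported_in M S ->
  measurable A -> leb.-integrable A (EFin \o divergence S).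
Proof.
move=> CS sS mA; apply: supported_integrable mA; first exact: divergence_continuous.
exact: divergence_supported sS.
Qed.

Lemma integral_divergenceE M S A : C1 S -> field_supported_in M S ->
  measurable A ->
  (\int[leb]_(x in A) (divergence S x)%:E)%E = (\int[leb]_(x in A) divergence S x)%:E.
Proof.
move=> CS sS mA; rewrite /Rintegral fineK//; apply: integrable_fin_num => //.
exact: (divergence_integrable CS sS).
Qed.

Lemma measurable_symdiff A B : measurable A -> measurable B -> measurable (A `+` B).
Proof. by move=> mA mB; apply: measurableU; exact: measurableD. Qed.

Lemma Rintegral_symdiff_eq f A B : (forall x, (A `+` B) x -> f x = 0) ->
  \int[leb]_(x in A) f x = \int[leb]_(x in B) f x.
Proof.
move=> f0; rewrite Rintegral_mkcond [RHS]Rintegral_mkcond.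
apply: eq_Rintegral => x _; rewrite !patchE.
case: (boolP (x \in A)); case: (boolP (x \in B)) => //; rewrite notin_setE inE => xB xA.
  by apply: f0; left; split.
by apply/esym; apply: f0; right; split.
Qed.

Lemma Rintegral_symdiff_le (f : 'rV[R]_n -> R) (M K : R) A B : continuous f ->
  supported_in M f -> (forall x, `|f x| <= K) ->
  measurable A -> measurable B -> (leb (A `+` B) < +oo)%E ->
  \int[leb]_(x in A) f x <= \int[leb]_(x in B) f x + K * fine (leb (A `+` B)).
Proof.
move=> cf sf fK mA mB fAB; have mAB := measurable_symdiff mA mB.
have if_ D : measurable D -> leb.-integrable D (EFin \o f).
  by move=> mD; exact: (supported_integrable cf sf mD).
have K0 : 0 <= K := le_trans (normr_ge0 _) (fK 0).
have iI : leb.-integrable setT (EFin \o fun x => K * \1_(A `+` B) x).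
  exact: integrable_scale_indic.
have -> : K * fine (leb (A `+` B)) = \int[leb]_x (K * \1_(A `+` B) x).
  have i1 : leb.-integrable setT (EFin \o fun x => 1 * (\1_(A `+` B) x : R)).
    exact: integrable_scale_indic.
  rewrite RintegralZl//; last first.
    by move: i1; rewrite /comp; under eq_fun do rewrite mul1r.
  by rewrite /Rintegral integral_indic// setIT.
rewrite Rintegral_mkcond [X in _ <= X + _]Rintegral_mkcond.
have iA (D : set (eucl R n)) : measurable D ->
    leb.-integrable setT (EFin \o ((f : eucl R n -> R) \_ D)).
  move=> mD; have /(integrable_mkcond _ mD) := if_ D mD.
  by rewrite restrict_EFin.
rewrite -RintegralD//; [|exact: iA].
apply: le_Rintegral => //; first exact: iA.
  rewrite (_ : _ \o _ = (EFin \o ((f : eucl R n -> R) \_ B)) \+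
      (EFin \o fun x => K * \1_(A `+` B) x))//.
  by apply: integrableD => //; exact: iA.
move=> x _; rewrite !patchE indicE.
have := fK x; rewrite ler_norml => /andP[f1 f2].
case: (boolP (x \in A)); case: (boolP (x \in B)); rewrite ?notin_setE ?inE => xB xA.
- by rewrite lerDl mulr_ge0.
- have -> : (x \in A `+` B) by rewrite inE; left; split.
  by rewrite mulr1 add0r.
- have -> : (x \in A `+` B) by rewrite inE; right; split.
  by rewrite mulr1 -lerBlDr sub0r.
- by rewrite add0r mulr_ge0.
Qed.

End fields_integrals.

Section ball_divergence.
Context {R : realType} {n : nat}.
Local Notation leb := (@lebesgue R n).
Implicit Types (S T W : 'rV[R]_n -> 'rV[R]_n) (x y : 'rV[R]_n).

Lemma eball_fin y r : (leb (eball y r) < +oo)%E.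
Proof.
have [r0|r0] := ltP 0 r.
  rewrite lebesgue_eball//; apply: lte_mul_pinfty => //.
    by rewrite lee_fin exprn_ge0// ltW.
  exact: lebesgue_unit_ball_fin.
rewrite (_ : eball y r = set0) ?measure0//; apply/seteqP; split => x //.
by rewrite /eball /= ltNge (le_trans r0)// enorm_ge0.
Qed.

Lemma in_eball_sqdist y r x : 0 < r -> eball y r x <-> sqdist y x < r ^+ 2.
Proof.
move=> r0; rewrite sqdistE /eball /=.
by rewrite ltr_pXn2r// nnegrE ?enorm_ge0// ltW.
Qed.

Lemma sqdist_continuous y : continuous (sqdist y).
Proof. exact: (C1_continuous (C1_sqdist y)). Qed.

(** Half of the divergence theorem on a ball, without surface measure.  Multiply W
    by a radial cut-off equal to 1 except on a shell of width of order 1/k, where its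
    gradient has size of order k.  The divergence of the product has integral 0; the
    term with the gradient of the cut-off is of order at most 1 on the shell, since
    there the radial component of W is at most of order 1/k; and the measure of the
    shell tends to 0. *)
Lemma ball_divergence_le0 y r C W : 0 < r -> 0 <= C -> C1 W ->
  (forall x, sqdist y x < r ^+ 2 -> dot (x - y) (W x) <= C * (r ^+ 2 - sqdist y x)) ->
  \int[leb]_(x in eball y r) divergence W x <= 0.
Proof.
move=> r0 C0 CW HW.
pose B : set (eucl R n) := eball y r.
have mB : measurable B by exact: measurable_eball.
pose q := sqdist y; have cq : continuous q by exact: sqdist_continuous.
pose V (k : nat) (x : 'rV[R]_n) := step k.+1%:R (r ^+ 2) (q x) *: W x.
have CV k : C1 (V k).
  by apply: C1Z => //; exact: (C1_comp (is_derive_step _ _) (@dstep_continuous _ _ _) (C1_sqdist y)).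
have sV k : field_supported_in (`|y| + r) (V k).
  move=> x xM; rewrite /V step_eq0 ?scale0r//.
  rewrite leNgt; apply/negP => /(in_eball_sqdist _ _ r0); rewrite /eball /=.
  move=> xy; have := norm_le_enorm (x - y); have := ler_normD (x - y) y.
  rewrite subrK; lra.
pose shell k : set (eucl R n) := [set x | k.+1%:R * (r ^+ 2 - q x) < 1].
have mshell k : measurable (shell k).
  apply: open_measurable_eucl.
  rewrite (_ : shell k = (fun x => k.+1%:R * (r ^+ 2 - q x)) @^-1` [set t | t < 1])//.
  apply: open_comp => [x _|]; last exact: open_lt.
  have cc : continuous (fun x => k.+1%:R * (r ^+ 2 - q x)).
    apply: continuous_mul; first exact: cst_continuous.
    by apply: continuous_sub; [exact: cst_continuous|exact: cq].
  exact: cc.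
have dV k x : divergence (V k) x = step k.+1%:R (r ^+ 2) (q x) * divergence W x +
    2 * dstep k.+1%:R (r ^+ 2) (q x) * dot (x - y) (W x).
  exact: (divergence_radial y (is_derive_step _ _) (@dstep_continuous _ _ _) CW x).
pose h k x := step k.+1%:R (r ^+ 2) (q x) * divergence W x - (8 * C) * \1_(shell k) x.
have cstep k : continuous (fun x => step k.+1%:R (r ^+ 2) (q x) * divergence W x).
  apply: continuous_mul; last exact: divergence_continuous.
  exact: (C1_continuous (C1_comp (is_derive_step _ _) (@dstep_continuous _ _ _) (C1_sqdist y))).
have mh k : measurable_fun B (h k).
  apply: measurable_funB; apply: measurable_funTS.
    exact: continuous_measurable_eucl.
  by apply: measurable_funM => //; exact: measurable_indic.
(* On the shell the cut-off has slope at most 4 k, and k times the radial component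
   of W is at most C. *)
have hV k x : B x -> h k x <= divergence (V k) x.
  move=> /(in_eball_sqdist _ _ r0) xB; rewrite dV /h lerD2l indicE.
  have k0 : 0 <= k.+1%:R :> R by [].
  have [xs|xs] := boolP (x \in _).
    move: xs; rewrite inE /shell /= -/q => xs.
    have d0 := dstep_le0 (r ^+ 2) (q x) k0.
    have d4 := dstep_ge (r ^+ 2) (q x) k0.
    have Hx := HW x xB; rewrite -/q in Hx xB.
    move: d0 d4 Hx; set d := dstep _ _ _; set w := dot _ _ => d0 d4 Hx.
    have H1 : d * (C * (r ^+ 2 - q x)) <= d * w by rewrite ler_wnM2l.
    have Cq : 0 <= C * (r ^+ 2 - q x) by rewrite mulr_ge0// subr_ge0 ltW.
    have H2 : - (4 * k.+1%:R) * (C * (r ^+ 2 - q x)) <= d * (C * (r ^+ 2 - q x)).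
      by rewrite ler_wpM2r.
    have H3 : C * (k.+1%:R * (r ^+ 2 - q x)) <= C by rewrite ler_piMr// ltW.
    rewrite mulr1; nra.
  move: xs; rewrite notin_setE /shell /= => /negP; rewrite -leNgt => xs.
  by rewrite dstep_eq0l// !(mulr0, mul0r) oppr0.
have [K K0 WK] : exists2 K, 0 <= K & forall x, B x -> `|divergence W x| <= K.
  have [K K0 HK] := @bounded_on_cube _ _ _ (`|y| + r) (divergence_continuous CW).
  exists K => // x; rewrite /B /eball /= => xB; apply: HK.
  have := norm_le_enorm (x - y); have := ler_normD (x - y) y.
  rewrite subrK; lra.
have hK k x : B x -> `|h k x| <= K + 8 * C.
  move=> xB; apply: (le_trans (ler_normB _ _)); apply: lerD.
    rewrite normrM (ger0_norm (step_ge0 _ _ _)).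
    apply: le_trans (WK x xB); rewrite ler_piMl// step_le1//.
  rewrite ger0_norm; last by rewrite !mulr_ge0.
  by rewrite ler_piMr ?mulr_ge0// indicE lern1 leq_b1.
have hlim x : B x -> (h k x)%:E @[k --> \oo] --> (divergence W x)%:E.
  move=> /(in_eball_sqdist _ _ r0) xB; rewrite -/q in xB.
  apply: cvg_near_cst; near=> k.
  have k1 : 1 <= k.+1%:R * (r ^+ 2 - q x).
    rewrite -ler_pdivrMr ?subr_gt0// div1r.
    near: k; exists (Num.truncn (r ^+ 2 - q x)^-1) => // m /= km.
    apply: (le_trans (ltW (truncnS_gt _))).
    by rewrite ler_nat ltnS.
  rewrite /h step_eq1// mul1r indicE memNset ?mulr0 ?subr0//.
  by rewrite /shell /=; apply/negP; rewrite -leNgt.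
have ic : leb.-integrable B (EFin \o cst (K + 8 * C)).
  apply: measurable_bounded_integrable => //; first exact: eball_fin.
  exists `|K + 8 * C|; split; first exact: num_real.
  by move=> L KL x _ /=; exact: ltW.
have ih k : leb.-integrable B (EFin \o h k).
  apply: le_integrable ic => //; first exact/measurable_EFinP.
  by move=> x Bx /=; rewrite lee_fin (le_trans (hK k x Bx))// ler_norm.
have ihV k : \int[leb]_(x in B) h k x <= 0.
  have <- : \int[leb]_(x in B) divergence (V k) x = 0.
    rewrite -(Rintegral_divergence0 (CV k) (sV k)).
    apply: Rintegral_symdiff_eq => x [[_ /(_ I)]//|[_ /= xB]].
    rewrite dV; have {}xB : r ^+ 2 <= q x.
      by rewrite leNgt; apply/negP => /(in_eball_sqdist _ _ r0).
    by rewrite step_eq0// dstep_eq0r// !(mul0r, mulr0) addr0.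
  apply: le_Rintegral => //.
  - exact: (divergence_integrable (CV k) (sV k)).
  - by move=> x Bx; exact: hV.
have mhE k : measurable_fun B (EFin \o h k) by exact/measurable_EFinP.
have mW : measurable_fun B (EFin \o divergence W).
  apply/measurable_EFinP; apply: measurable_funTS; apply: continuous_measurable_eucl.
  exact: divergence_continuous.
have a1 : {ae leb, forall x, B x -> (h k x)%:E @[k --> \oo] --> (divergence W x)%:E}.
  exact: aeW.
have a2 : {ae leb, forall x k, B x -> (`|(h k x)%:E| <= (K + 8 * C)%:E)%E}.
  by apply: aeW => x k Bx; rewrite lee_fin; exact: hK.
have [iW _ cv] := @dominated_convergence _ _ _ leb B mB (fun k x => (h k x)%:E)
  (EFin \o divergence W) (EFin \o cst (K + 8 * C)) mhE mW
  a1 ic a2.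
have : (\int[leb]_(x in B) (divergence W x)%:E <= 0)%E.
  rewrite -(cvg_lim _ cv)//; apply: lime_le; first by apply/cvg_ex; eexists; exact: cv.
  apply: nearW => k /=; have := ihV k; rewrite /Rintegral -lee_fin fineK//.
  by apply: integrable_fin_num => //; exact: ih.
by rewrite /Rintegral -lee_fin fineK//; apply: integrable_fin_num.
Unshelve. all: by end_near. Qed.

End ball_divergence.

(** * The perimeter of a ball and its calibration *)

Section perimeter_basics.
Context {R : realType} {n : nat}.
Local Notation leb := (@lebesgue R n).
Implicit Types (S : 'rV[R]_n -> 'rV[R]_n) (x y : 'rV[R]_n) (E F : set (eucl R n)).
Implicit Types (Omega : set 'rV[R]_n).

Lemma C1c_C1 Omega S : C1c Omega S -> C1 S.
Proof. by case=> dS cJ _; apply/C1_jacobian. Qed.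

Lemma C1c_supported Omega S : C1c Omega S -> exists M, field_supported_in M S.
Proof.
case=> _ _ [cS _].
have [M [_ HM]] := compact_bounded cS.
exists (M + 1) => x xM; apply/eqP/negPn/negP => Sx.
have : `|x| <= M + 1 by apply: (HM (M + 1)); [rewrite ltrDl|exact: subset_closure].
by rewrite leNgt xM.
Qed.

Lemma C1cI Omega S : C1 S -> compactly_contained [set x | S x != 0] Omega ->
  C1c Omega S.
Proof. by move=> /C1_jacobian[dS cJ] cS; split. Qed.

Lemma closure_sub_closed (T : topologicalType) (A B : set T) :
  closed B -> A `<=` B -> closure A `<=` B.
Proof. by move=> cB AB; rewrite (closure_id B).1//; exact: closure_subset. Qed.

Lemma supported_compactly_contained M S : field_supported_in M S ->
  compactly_contained [set x | S x != 0] setT.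
Proof.
move=> sS; split=> //; apply: subclosed_compact (@closed_closure _ _) (@cube_compact _ _ M) _.
apply: closure_sub_closed; first exact: cube_closed.
by move=> x /= Sx; rewrite /cube /= leNgt; apply: contra Sx => /sS ->.
Qed.

Lemma perimeter_ge Omega E S : measurable E -> C1c Omega S ->
  (forall x, enorm (S x) <= 1) ->
  ((\int[leb]_(x in E) divergence S x)%:E <= perimeter_in E Omega)%E.
Proof.
move=> mE cS S1; have [M sS] := C1c_supported cS.
rewrite -(integral_divergenceE (C1c_C1 cS) sS mE).
by apply: ereal_sup_ubound; exists S.
Qed.

Lemma perimeter_le Omega E (b : \bar R) : measurable E ->
  (forall S, C1c Omega S -> (forall x, enorm (S x) <= 1) ->
    ((\int[leb]_(x in E) divergence S x)%:E <= b)%E) ->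
  (perimeter_in E Omega <= b)%E.
Proof.
move=> mE H; apply: ge_ereal_sup => _ [S [cS S1] <-].
have [M sS] := C1c_supported cS.
by rewrite (integral_divergenceE (C1c_C1 cS) sS mE); exact: H.
Qed.

Lemma perimeter_ge0 Omega E : measurable E -> (0 <= perimeter_in E Omega)%E.
Proof.
move=> mE; have c0 : C1c Omega (fun=> 0 : 'rV[R]_n).
  apply: C1cI; first exact: C1_cst.
  rewrite (_ : [set _ | _] = set0); last by apply/seteqP; split=> x //=; rewrite eqxx.
  by rewrite /compactly_contained closure0; split; [exact: compact0|].
apply: le_trans (perimeter_ge mE c0 _) => [|x]; last by rewrite enorm0.
rewrite (_ : \int[leb]_(x in E) _ = 0)//.
rewrite (@eq_Rintegral _ _ _ _ _ (cst 0)) ?Rintegral_cst ?mul0r// => x _.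
rewrite (divergenceE _ x) big1// => i _.
have -> : 'd (fun _ : 'rV[R]_n => 0 : 'rV[R]_n) x 'e_i = 0 by rewrite diff_cst.
by rewrite mxE.
Qed.

Lemma perimeter_in_le Omega E : measurable E ->
  (perimeter_in E Omega <= perimeter E)%E.
Proof.
move=> mE; apply: perimeter_le => // S cS S1; apply: perimeter_ge => //.
have [M sS] := C1c_supported cS; apply: C1cI; first exact: C1c_C1 cS.
exact: supported_compactly_contained sS.
Qed.

End perimeter_basics.

Section balls.
Context {R : realType} {n : nat}.
Local Notation leb := (@lebesgue R n).
Implicit Types (S : 'rV[R]_n -> 'rV[R]_n) (x y : 'rV[R]_n) (E F : set (eucl R n)).

Lemma C1_subr y : C1 (fun x : 'rV[R]_n => x - y).
Proof. exact: (C1B C1_id (C1_cst y)). Qed.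

Lemma divergence_subr y x : divergence (fun x : 'rV[R]_n => x - y) x = n%:R.
Proof.
apply: (etrans (divergenceB C1_id (C1_cst y) x)); rewrite divergence_id.
suff -> : divergence (fun _ : 'rV[R]_n => y) x = 0 by rewrite subr0.
rewrite (divergenceE _ x) big1// => i _.
have -> : 'd (fun _ : 'rV[R]_n => y) x 'e_i = 0 by rewrite diff_cst.
by rewrite mxE.
Qed.

Lemma C1_scale (a : R) S : C1 S -> C1 (fun x => a *: S x).
Proof. by move=> CS; exact: (C1Z (C1_cst a) CS). Qed.

Lemma divergence_scale (a : R) S x : C1 S ->
  divergence (fun x => a *: S x) x = a * divergence S x.
Proof.
move=> CS; rewrite (divergenceE _ x) (divergenceE S x) mulr_sumr.
apply: eq_bigr => i _.
apply: (etrans (diffZ_coord (C1_cst a) CS x _ i)).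
have -> : 'd (fun _ : 'rV[R]_n => a) x 'e_i = 0 by rewrite diff_cst.
by rewrite mulr0 addr0.
Qed.

Lemma integrable_cst_eball (a : R) y r : leb.-integrable (eball y r) (EFin \o cst a).
Proof.
apply: measurable_bounded_integrable => //.
- exact: measurable_eball.
- exact: eball_fin.
- exists `|a|; split; first exact: num_real.
  by move=> L KL x _ /=; exact: ltW.
Qed.

(** On the sphere (x - y) / r is the outer normal, hence has at least the flux of
    S; its divergence is n / r. *)
Lemma ball_flux_le y r S M : 0 < r -> C1 S -> field_supported_in M S ->
  (forall x, enorm (S x) <= 1) ->
  \int[leb]_(x in eball y r) divergence S x <= n%:R / r * fine (leb (eball y r)).
Proof.
move=> r0 CS sS S1.
have mB : measurable (eball y r : set (eucl R n)) by exact: measurable_eball.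
have CN : C1 (fun x : 'rV[R]_n => r^-1 *: (x - y)) := C1_scale _ (C1_subr y).
have := ball_divergence_le0 r0 (_ : 0 <= r^-1) (C1B CS CN) _.
rewrite invr_ge0 (ltW r0) => /(_ y isT).
have E x : divergence (fun x => S x - r^-1 *: (x - y)) x = divergence S x - n%:R / r.
  apply: (etrans (divergenceB CS CN x)); congr (_ - _).
  by apply: (etrans (divergence_scale _ _ (C1_subr y))); rewrite divergence_subr mulrC.
rewrite (funext E : divergence _ = _) => H; move: H.
rewrite RintegralB//; last 2 first.
- exact: (divergence_integrable CS sS).
- exact: integrable_cst_eball.
rewrite Rintegral_cst// subr_le0; apply => x xr.
rewrite dotBr dotZr -sqr_enorm sqdistE.
have [e0 e1] := (enorm_ge0 (x - y), dot_le (x - y) (S x)).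
have ler : enorm (x - y) < r.
  by move: xr; rewrite sqdistE ltr_pXn2r// nnegrE ltW.
have : dot (x - y) (S x) <= enorm (x - y).
  by apply: (le_trans e1); rewrite ler_piMr.
rewrite mulrBr.
have ri : r^-1 * r ^+ 2 = r by rewrite expr2 mulrA mulVf ?mul1r// gt_eqF.
by rewrite ri; lra.
Qed.

Lemma perimeter_eball_le y r : 0 < r ->
  (perimeter (eball y r) <= (n%:R / r * fine (leb (eball y r)))%:E)%E.
Proof.
move=> r0; apply: perimeter_le; first exact: measurable_eball.
move=> S cS S1; have [M sS] := C1c_supported cS.
by rewrite lee_fin; apply: (ball_flux_le y r0 (C1c_C1 cS) sS).
Qed.

(** With a = |x - y| / r, the calibration field below has norm a (5 - a^2)^2 / 16 for
    a^2 <= 5: this has maximum 1, attained at a = 1, i.e. on the sphere, where the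
    field is the outer normal.  The positive part squared gives it compact support
    while keeping it C1. *)
Definition calibration_profile r (s : R) : R := pos2 (5 - s / r ^+ 2) / (16 * r).

Definition calibration_dprofile r (s : R) : R :=
  - (2 * Num.max (5 - s / r ^+ 2) 0 / (16 * r ^+ 3)).

Definition calibration y r x : 'rV[R]_n :=
  calibration_profile r (sqdist y x) *: (x - y).

Lemma is_derive_calibration_profile (r s : R) : 0 < r ->
  is_derive s 1 (calibration_profile r) (calibration_dprofile r s).
Proof.
move=> r0; have d1 : is_derive s 1 (fun s : R => 5 - s / r ^+ 2) (- r ^- 2).
  apply: (@is_derive_quadratic _ _ _ _ 0) => h; rewrite mul0r.
  by rewrite (_ : _ - _ = 0) ?normr0//; ring.
have d2 := @is_derive1_comp _ pos2 (fun s : R => 5 - s / r ^+ 2) s _ _ (is_derive_pos2 _) d1.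
have d3 := is_deriveZ (16 * r)^-1 d2.
have -> : calibration_profile r = (16 * r)^-1 *: (pos2 \o (fun s : R => 5 - s / r ^+ 2)).
  by apply/funext => t; rewrite /calibration_profile mulrC.
have -> : calibration_dprofile r s = (16 * r)^-1 *: (2 * Num.max (5 - s / r ^+ 2) 0 * - r ^- 2) => //.
rewrite /calibration_dprofile /GRing.scale /=; set m := Num.max _ _.
by field; rewrite gt_eqF.
Qed.

Lemma calibration_dprofile_continuous (r : R) : continuous (calibration_dprofile r).
Proof.
have c1 : continuous (fun s : R => 5 - s / r ^+ 2).
  apply: continuous_sub; first exact: cst_continuous.
  by apply: continuous_mul; [move=> x; exact: cvg_id|exact: cst_continuous].
have c2 : continuous (fun s : R => Num.max (5 - s / r ^+ 2) 0).
  move=> s; apply: (@continuous_comp _ _ _ (fun s : R => 5 - s / r ^+ 2) (fun t : R => Num.max t 0)).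
    exact: c1.
  exact: pos_continuous.
move=> s; apply: cvgN; move: s.
apply: continuous_mul; last exact: cst_continuous.
by apply: continuous_mul; first exact: cst_continuous.
Qed.

Lemma C1_calibration y r : 0 < r -> C1 (calibration y r).
Proof.
move=> r0; apply: C1Z (C1_subr y).
exact: (C1_comp (fun t => is_derive_calibration_profile t r0) (@calibration_dprofile_continuous r) (C1_sqdist y)).
Qed.

Lemma calibration_le1 y r x : 0 < r -> enorm (calibration y r x) <= 1.
Proof.
move=> r0; rewrite /calibration enormZ /calibration_profile sqdistE.
set e := enorm _; have e0 : 0 <= e by exact: enorm_ge0.
rewrite ger0_norm; last by rewrite divr_ge0 ?pos2_ge0// mulr_ge0// ltW.
pose a := e / r; have a0 : 0 <= a by rewrite divr_ge0// ltW.
have -> : pos2 (5 - e ^+ 2 / r ^+ 2) / (16 * r) * e = a * pos2 (5 - a ^+ 2) / 16.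
  by rewrite /a expr_div_n; field; rewrite gt_eqF.
have [a5|a5] := leP (a ^+ 2) 5; last first.
  by rewrite pos2_eq0 ?mulr0 ?mul0r// subr_le0 ltW.
rewrite pos2E ?subr_ge0// ler_pdivrMr// mul1r.
(* The double root at a = 1 reflects the maximum there. *)
have -> : 16 = a * (5 - a ^+ 2) ^+ 2 + (1 - a) ^+ 2 * (16 + 7 * a - 2 * a ^+ 2 - a ^+ 3) by ring.
rewrite lerDl mulr_ge0 ?sqr_ge0//.
have -> : 16 + 7 * a - 2 * a ^+ 2 - a ^+ 3 = 6 + 2 * a + (2 + a) * (5 - a ^+ 2) by ring.
by rewrite addr_ge0// ?mulr_ge0 ?subr_ge0// addr_ge0// mulr_ge0.
Qed.

Lemma calibration_supported y r : 0 < r ->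
  field_supported_in (`|y| + 3 * r) (calibration y r).
Proof.
move=> r0 x xM; rewrite /calibration /calibration_profile pos2_eq0 ?mul0r ?scale0r//.
rewrite subr_le0 ler_pdivlMr ?exprn_gt0// sqdistE.
have : 3 * r <= enorm (x - y).
  by have := norm_le_enorm (x - y); have := ler_normD (x - y) y; rewrite subrK; lra.
have := enorm_ge0 (x - y); nra.
Qed.

(** Inside the ball the profile is at least 1 / r, its value on the sphere, so the
    radial component of the calibration is at least that of (x - y) / r, whose
    divergence is n / r. *)
Lemma calibration_flux y r : 0 < r ->
  n%:R / r * fine (leb (eball y r)) <=
  \int[leb]_(x in eball y r) divergence (calibration y r) x.
Proof.
move=> r0.
have mB : measurable (eball y r : set (eucl R n)) by exact: measurable_eball.
have CN : C1 (fun x : 'rV[R]_n => r^-1 *: (x - y)) := C1_scale _ (C1_subr y).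
have CT := C1_calibration y r0.
have := ball_divergence_le0 r0 (lexx 0) (C1B CN CT) _.
move=> /(_ y).
have E x : divergence (fun x => r^-1 *: (x - y) - calibration y r x) x =
    n%:R / r - divergence (calibration y r) x.
  apply: (etrans (divergenceB CN CT x)); congr (_ - _).
  by apply: (etrans (divergence_scale _ _ (C1_subr y))); rewrite divergence_subr mulrC.
rewrite (funext E : divergence _ = _) => H; move: H.
rewrite RintegralB//; last 2 first.
- exact: integrable_cst_eball.
- exact: (divergence_integrable CT (@calibration_supported y r r0) mB).
rewrite Rintegral_cst// subr_le0; apply => x xr.
rewrite mul0r dotBr /calibration !dotZr -mulrBl mulr_le0_ge0 ?dot_ge0//.
rewrite subr_le0 /calibration_profile.
have s1 : sqdist y x / r ^+ 2 <= 1 by rewrite ler_pdivrMr ?exprn_gt0// mul1r ltW.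
rewrite pos2E; last by lra.
rewrite ler_pdivlMr ?mulr_gt0// mulrCA mulVf ?gt_eqF// mulr1.
by move: s1; set s := _ / _; nra.
Qed.

Lemma perimeter_eball y r : 0 < r ->
  perimeter (eball y r) = (n%:R / r * fine (leb (eball y r)))%:E.
Proof.
move=> r0; apply/eqP; rewrite eq_le perimeter_eball_le//=.
have cT : C1c setT (calibration y r).
  apply: C1cI; first exact: C1_calibration.
  exact: (supported_compactly_contained (@calibration_supported y r r0)).
apply: le_trans (perimeter_ge (measurable_eball y r) cT _) => [|x].
  by rewrite lee_fin calibration_flux.
exact: calibration_le1.
Qed.

(** The bound does not depend on the centre, as needed for balls that only
    approximate a set. *)
Lemma calibration_divergence_le y x : `|divergence (calibration y 1) x| <= 2 * n%:R + 2.
Proof.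
have -> : divergence (calibration y 1) x =
    calibration_profile 1 (sqdist y x) * n%:R + 2 * calibration_dprofile 1 (sqdist y x) * sqdist y x.
  apply: (etrans (divergence_radial y (fun t => is_derive_calibration_profile t ltr01)
    (@calibration_dprofile_continuous 1) (C1_subr y) x)).
  by rewrite divergence_subr.
have : 0 <= sqdist y x by exact: dot_ge0.
move: (sqdist y x) => s s0.
have n0 : 0 <= n%:R :> R by [].
rewrite /calibration_profile /calibration_dprofile !expr1n !divr1 !mulr1.
have [s5|s5] := leP s 5.
  rewrite pos2E ?subr_ge0// max_l ?subr_ge0//.
  have H1 : 0 <= (5 - s) ^+ 2 / 16 <= 2.
    by rewrite divr_ge0 ?sqr_ge0//= ler_pdivrMr//; nra.
  have H2 : -2 <= 2 * - (2 * (5 - s) / 16) * s <= 0.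
    by apply/andP; split; nra.
  by rewrite ler_norml; apply/andP; split; nra.
rewrite pos2_eq0 ?max_r; try by rewrite subr_le0 ltW.
by rewrite !(mul0r, mulr0, oppr0) addr0 normr0 addr_ge0// mulr_ge0.
Qed.

End balls.

(** * Quasi-minimality of balls; localization of the perimeter *)

Section quasiminimality.
Context {R : realType} {n : nat}.
Local Notation leb := (@lebesgue R n).
Implicit Types (S : 'rV[R]_n -> 'rV[R]_n) (x y : 'rV[R]_n) (A B C E F : set (eucl R n)).
Local Notation omega := (fine (leb (eball 0 1))).

Lemma symdiffC A B : A `+` B = B `+` A.
Proof. by rewrite /setY setUC. Qed.

Lemma symdiff_triangle A B C : measurable A -> measurable B -> measurable C ->
  (leb (A `+` C) <= leb (A `+` B) + leb (B `+` C))%E.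
Proof.
move=> mA mB mC.
have mAB := measurable_symdiff mA mB; have mBC := measurable_symdiff mB mC.
apply: (@le_trans _ _ (leb ((A `+` B) `|` (B `+` C)))).
  apply: le_measure; rewrite ?inE; [exact: measurable_symdiff|exact: measurableU|].
  move=> x [[Ax nCx]|[Cx nAx]]; have [Bx|nBx] := pselect (B x).
  - by right; left.
  - by left; left.
  - by left; right.
  - by right; right.
exact: measureU2.
Qed.

Lemma lebesgue_eball1 y : leb (eball y 1) = leb (eball 0 1).
Proof. by rewrite lebesgue_eball// expr1n mul1e. Qed.

(** Calibration: the field has flux n omega, the perimeter of the ball, through the
    ball, and at most the perimeter of F through F; the two fluxes differ by the
    integral of a bounded divergence over the symmetric difference. *)
Lemma unit_ball_quasiminimal y F : measurable F ->
  ((n%:R * omega)%:E <= perimeter F + (2 * n%:R + 2)%R%:E * leb (eball y 1 `+` F))%E.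
Proof.
move=> mF; have mB : measurable (eball y 1 : set (eucl R n)) by exact: measurable_eball.
have L0 : 0 < 2 * n%:R + 2 :> R by rewrite ltr_wpDl// mulr_ge0.
have P0 := @perimeter_ge0 R n setT F mF.
have [fBF|] := boolP (leb (eball y 1 `+` F) < +oo)%E; last first.
  rewrite -leNgt leye_eq => /eqP ->.
  rewrite gt0_muley ?lte_fin// addey ?leey// -ltNye.
  exact: lt_le_trans P0.
have CT : C1 (calibration y 1) by exact: C1_calibration.
have sT := @calibration_supported R n y 1 ltr01.
have H1 := calibration_flux (n := n) y ltr01; rewrite divr1 lebesgue_eball1 in H1.
have H2 := Rintegral_symdiff_le (divergence_continuous CT)
  (divergence_supported CT sT) (calibration_divergence_le y) mB mF fBF.
have cT : C1c setT (calibration y 1).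
  apply: C1cI => //; exact: (supported_compactly_contained sT).
have H3 := perimeter_ge mF cT (fun x => calibration_le1 y x ltr01).
have fd : leb (eball y 1 `+` F) \is a fin_num by rewrite ge0_fin_numE.
apply: (@le_trans _ _ ((\int[leb]_(x in F) divergence (calibration y 1) x)%:E +
  (2 * n%:R + 2)%R%:E * leb (eball y 1 `+` F))%E); last by rewrite leeD2r.
by rewrite -(fineK fd) -EFinM -EFinD lee_fin (le_trans H1).
Qed.

(** Lower semicontinuity of the perimeter: the flux of a fixed test field is
    continuous for the volume of the symmetric difference. *)
Lemma perimeter_le_near_unit_balls E : measurable E ->
  (forall e : R, 0 < e -> exists y, (leb (E `+` eball y 1) < e%:E)%E) ->
  (perimeter E <= (n%:R * omega)%:E)%E.
Proof.
move=> mE HE; apply: perimeter_le => // S cS S1.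
have [M sS] := C1c_supported cS; have CS := C1c_C1 cS.
have [K K0 HK] := supported_bounded (divergence_continuous CS) (divergence_supported CS sS).
rewrite lee_fin; apply/ler_addgt0Pr => e e0.
have eK : 0 < e / (K + 1) by rewrite divr_gt0// ltr_wpDl.
have [y Hy] := HE _ eK.
have mB : measurable (eball y 1 : set (eucl R n)) by exact: measurable_eball.
have fy : (leb (E `+` eball y 1) < +oo)%E by apply: lt_trans Hy _; exact: ltry.
have H1 := Rintegral_symdiff_le (divergence_continuous CS)
  (divergence_supported CS sS) HK mE mB fy.
have H2 := ball_flux_le y ltr01 CS sS S1; rewrite divr1 lebesgue_eball1 in H2.
apply: (le_trans H1); apply: lerD => //.
have fd : leb (E `+` eball y 1) \is a fin_num by rewrite ge0_fin_numE.
move: Hy; rewrite -(fineK fd) lte_fin ltr_pdivlMr ?ltr_wpDl// => Hy.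
have d0 : 0 <= fine (leb (E `+` eball y 1)) by exact: fine_ge0.
by rewrite fineK//; nra.
Qed.

(** The quasi-minimality of unit balls is uniform in the centre, so it passes to
    their limits. *)
Lemma near_unit_balls_quasiminimal E F : measurable E -> measurable F ->
  (forall e : R, 0 < e -> exists y, (leb (E `+` eball y 1) < e%:E)%E) ->
  (perimeter E <= perimeter F + (2 * n%:R + 2)%R%:E * leb (E `+` F))%E.
Proof.
move=> mE mF HE; apply: (le_trans (perimeter_le_near_unit_balls mE HE)).
have L0 : 0 < 2 * n%:R + 2 :> R by rewrite ltr_wpDl// mulr_ge0.
apply/lee_addgt0Pr => e e0.
have eL : 0 < e / (2 * n%:R + 2) by rewrite divr_gt0.
have [y Hy] := HE _ eL.
have mB : measurable (eball y 1 : set (eucl R n)) by exact: measurable_eball.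
apply: (le_trans (unit_ball_quasiminimal y mF)).
rewrite -addeA leeD2l//.
have L0' : (0 <= (2 * n%:R + 2 : R)%R%:E)%E by rewrite lee_fin ltW.
apply: (@le_trans _ _ ((2 * n%:R + 2)%R%:E * (leb (eball y 1 `+` E) + leb (E `+` F)))%E).
  by apply: lee_wpmul2l => //; exact: symdiff_triangle.
rewrite ge0_muleDr// addeC; apply: leeD2r.
apply: (@le_trans _ _ ((2 * n%:R + 2)%R%:E * (e / (2 * n%:R + 2))%R%:E)%E).
  by apply: lee_wpmul2l => //; rewrite symdiffC; exact: ltW.
by rewrite -EFinM lee_fin mulrCA divff ?mulr1// gt_eqF.
Qed.

End quasiminimality.

Section localization.
Context {R : realType} {n : nat}.
Local Notation leb := (@lebesgue R n).
Implicit Types (S phi psi : 'rV[R]_n -> 'rV[R]_n) (x y : 'rV[R]_n) (E F : set (eucl R n)).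

Lemma compact_in_smaller_eball (K : set 'rV[R]_n) x r : 0 < r -> compact K ->
  K `<=` eball x r -> exists2 t, 0 < t < r & K `<=` eball x t.
Proof.
move=> r0 cK Kr; have [->|/set0P nz] := eqVneq K set0.
  by exists (r / 2); [rewrite divr_gt0//= ltr_pdivrMr// ltr_pMr// ltr1n|].
have cn : {within K, continuous (fun y => enorm (y - x))}.
  apply: continuous_subspaceT.
  have cs : continuous (fun y : 'rV[R]_n => y - x) := C1_continuous (C1_subr x).
  move=> y; apply: (@continuous_comp _ _ _ (fun y : 'rV[R]_n => y - x) (@enorm R n)).
    exact: cs.
  exact: enorm_continuous.
have [c cK' Hc] := EVT_max_rV nz cK cn.
have cr : enorm (c - x) < r by apply: Kr; rewrite inE in cK'.
exists ((enorm (c - x) + r) / 2).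
  have := enorm_ge0 (c - x); rewrite ltr_pdivlMr// ltr_pdivrMr//; lra.
move=> y Ky; rewrite /eball /=; apply: (@le_lt_trans _ _ (enorm (c - x))).
  by apply: Hc; rewrite inE.
rewrite ltr_pdivlMr//; lra.
Qed.

Lemma closed_cball x (t : R) : closed [set y : 'rV[R]_n | enorm (y - x) <= t].
Proof.
have cs : continuous (fun y : 'rV[R]_n => y - x) := C1_continuous (C1_subr x).
rewrite (_ : [set y | _] = (fun y : 'rV[R]_n => enorm (y - x)) @^-1` [set s | s <= t])//.
apply: closed_comp => [y _|]; last exact: closed_le.
apply: (@continuous_comp _ _ _ (fun y : 'rV[R]_n => y - x) (@enorm R n)).
  exact: cs.
exact: enorm_continuous.
Qed.

Lemma compact_cball x (t : R) : compact [set y : 'rV[R]_n | enorm (y - x) <= t].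
Proof.
apply: subclosed_compact (@closed_cball x t) (@cube_compact _ _ (t + `|x|)) _.
move=> y /= yt; have := norm_le_enorm (y - x); have := ler_normD (y - x) x.
rewrite subrK /cube /=; lra.
Qed.

Let exchange_arith (a b c d u1 u2 v w s1 s2 : R) :
  s1 = a - b - u1 -> s2 = c - d - u2 -> s1 = s2 ->
  v = a - u1 -> w = d + u2 -> b + c <= v + w.
Proof. lra. Qed.

(** If E and F differ only inside a ball, their perimeters differ by the same
    amount in the ball and in the whole space.  With a cut-off eta equal to 1 near
    the difference, a test field psi in the ball and a test field phi in the whole
    space can exchange their exteriors: the fields eta psi + (1 - eta) phi and
    eta phi + (1 - eta) psi are again test fields, and their total flux is that of
    psi and phi, because (1 - eta) (phi - psi) has the same flux through E and F. *)
Lemma test_field_exchange E F x r phi psi : 0 < r ->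
  compactly_contained (E `+` F) (eball x r) ->
  measurable E -> measurable F ->
  C1c setT phi -> (forall y, enorm (phi y) <= 1) ->
  C1c (eball x r) psi -> (forall y, enorm (psi y) <= 1) ->
  ((\int[leb]_(y in E) divergence psi y + \int[leb]_(y in F) divergence phi y)%:E <=
   perimeter E + perimeter_in F (eball x r))%E.
Proof.
move=> r0 [cEF EFr] mE mF cphi phi1 cpsi psi1.
have [s /andP[s0 sr] EFs] := compact_in_smaller_eball r0 cEF EFr.
pose t := (s + r) / 2.
have st : s < t by rewrite ltr_pdivlMr//; lra.
have tr : t < r by rewrite ltr_pdivrMr//; lra.
pose k := (t ^+ 2 - s ^+ 2)^-1.
have k0 : 0 < k by rewrite invr_gt0 subr_gt0 ltr_pXn2r// nnegrE ltW// (lt_trans s0).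
pose eta y := step k (t ^+ 2) (sqdist x y).
have Ceta : C1 eta.
  exact: (C1_comp (is_derive_step _ _) (@dstep_continuous _ _ _) (C1_sqdist x)).
have [[M sphi] [N spsi]] := (C1c_supported cphi, C1c_supported cpsi).
have [Cphi Cpsi] := (C1c_C1 cphi, C1c_C1 cpsi).
pose S y := phi y - psi y.
have CS : C1 S := C1B Cphi Cpsi.
pose U y := eta y *: S y.
have CU : C1 U := C1Z Ceta CS.
pose theta y := phi y - U y.
pose xi y := psi y + U y.
have Cth : C1 theta := C1B Cphi CU.
have Cxi : C1 xi := C1D Cpsi CU.
have eta01 y : 0 <= eta y <= 1 by rewrite step_ge0 step_le1.
have eta_out y : ~ enorm (y - x) <= t -> eta y = 0.
  move=> /negP; rewrite -ltNge => ty; rewrite /eta step_eq0//; first exact: ltW.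
  by rewrite sqdistE lerXn2r// ?nnegrE ?enorm_ge0// ltW// (lt_trans s0).
have th1 y : enorm (theta y) <= 1.
  have -> : theta y = (1 - eta y) *: phi y + eta y *: psi y.
    by rewrite /theta /U /S scalerBr scalerBl scale1r opprB addrA addrAC.
  apply: (le_trans (enormD _ _)); rewrite !enormZ.
  case/andP: (eta01 y) => e0 e1; rewrite !ger0_norm// ?subr_ge0//.
  by have := phi1 y; have := psi1 y; nra.
have xi1 y : enorm (xi y) <= 1.
  have -> : xi y = (1 - eta y) *: psi y + eta y *: phi y.
    by rewrite /xi /U /S scalerBr scalerBl scale1r addrA addrAC.
  apply: (le_trans (enormD _ _)); rewrite !enormZ.
  case/andP: (eta01 y) => e0 e1; rewrite !ger0_norm// ?subr_ge0//.
  by have := phi1 y; have := psi1 y; nra.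
have sS y : M < `|y| -> N < `|y| -> S y = 0.
  by move=> yM yN; rewrite /S sphi// spsi// subr0.
have sth : field_supported_in (Num.max M N) theta.
  by move=> y; rewrite gt_max => /andP[yM yN]; rewrite /theta /U sS// scaler0 subr0 sphi.
have cth : C1c setT theta.
  by apply: C1cI => //; exact: (supported_compactly_contained sth).
have cxi : C1c (eball x r) xi.
  apply: C1cI => //; case: cpsi => _ _ [cK Kr].
  pose Q := closure [set y | psi y != 0] `|` [set y : 'rV[R]_n | enorm (y - x) <= t].
  have cQ : compact Q by apply: compactU => //; exact: compact_cball.
  have clQ : closed Q by apply: closedU; [exact: closed_closure|exact: closed_cball].
  have sQ : closure [set y | xi y != 0] `<=` Q.
    apply: closure_sub_closed => // y /= xiy.
    have [yt|yt] := pselect (enorm (y - x) <= t); first by right.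
    left; apply: subset_closure; move: xiy.
    by rewrite /= /xi /U eta_out// scale0r addr0.
  split; first exact: subclosed_compact (@closed_closure _ _) cQ sQ.
  move=> y /sQ[/Kr//|/= yt]; rewrite /eball /=; exact: le_lt_trans yt tr.
have sU : field_supported_in (Num.max M N) U.
  by move=> y; rewrite gt_max => /andP[yM yN]; rewrite /U sS// scaler0.
have sSm : field_supported_in (Num.max M N) S.
  by move=> y; rewrite gt_max => /andP[yM yN]; exact: sS.
have dth y : divergence theta y = divergence phi y - divergence U y.
  exact: (divergenceB Cphi CU).
have dxi y : divergence xi y = divergence psi y + divergence U y.
  exact: (divergenceD Cpsi CU).
have dS y : divergence S y = divergence phi y - divergence psi y.
  exact: (divergenceB Cphi Cpsi).
have dU y : divergence U y = eta y * divergence S y +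
    2 * dstep k (t ^+ 2) (sqdist x y) * dot (y - x) (S y).
  exact: (divergence_radial x (is_derive_step _ _) (@dstep_continuous _ _ _) CS y).
have key : \int[leb]_(y in E) (divergence S y - divergence U y) =
           \int[leb]_(y in F) (divergence S y - divergence U y).
  apply: Rintegral_symdiff_eq => y EFy.
  have ys : sqdist x y <= s ^+ 2.
    rewrite sqdistE lerXn2r ?nnegrE ?enorm_ge0// ?ltW//.
    by apply: EFs; exact: subset_closure.
  have ky : 1 <= k * (t ^+ 2 - sqdist x y).
    rewrite /k -ler_pdivrMl ?invr_gt0; last by rewrite -invr_gt0.
    by rewrite invrK mulr1 lerB.
  by rewrite dU /eta step_eq1// dstep_eq0l// mulr0 mul0r addr0 mul1r subrr.
have iphi A : measurable A -> leb.-integrable A (EFin \o divergence phi).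
  exact: (divergence_integrable Cphi sphi).
have ipsi A : measurable A -> leb.-integrable A (EFin \o divergence psi).
  exact: (divergence_integrable Cpsi spsi).
have iU A : measurable A -> leb.-integrable A (EFin \o divergence U).
  exact: (divergence_integrable CU sU).
have iS A : measurable A -> leb.-integrable A (EFin \o divergence S).
  exact: (divergence_integrable CS sSm).
have H1 := perimeter_ge mE cth th1.
have H2 := perimeter_ge mF cxi xi1.
apply: le_trans (leeD H1 H2); rewrite -EFinD lee_fin.
have IS A : measurable A -> \int[leb]_(y in A) (divergence S y - divergence U y) =
    \int[leb]_(y in A) divergence phi y - \int[leb]_(y in A) divergence psi y -
    \int[leb]_(y in A) divergence U y.
  move=> mA; apply: (etrans (RintegralB mA (iS _ mA) (iU _ mA))); congr (_ - _).
  apply: etrans (RintegralB mA (iphi _ mA) (ipsi _ mA)).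
  by apply: eq_Rintegral => y _; exact: dS.
have Ith : \int[leb]_(y in E) divergence theta y =
    \int[leb]_(y in E) divergence phi y - \int[leb]_(y in E) divergence U y.
  apply: etrans (RintegralB mE (iphi _ mE) (iU _ mE)).
  by apply: eq_Rintegral => y _; exact: dth.
have Ixi : \int[leb]_(y in F) divergence xi y =
    \int[leb]_(y in F) divergence psi y + \int[leb]_(y in F) divergence U y.
  apply: etrans (RintegralD mF (ipsi _ mF) (iU _ mF)).
  by apply: eq_Rintegral => y _; exact: dxi.
exact: (exchange_arith (IS _ mE) (IS _ mF) key Ith Ixi).
Qed.

(** The exchange of test fields bounds every flux of phi through F by the sum of
    P(E) and P(F, ball) minus the flux of psi through E.  Take the supremum over phi,
    compare with P(E), and cancel P(E), which is finite. *)
Lemma local_comparison E F x r (L : R) : 0 < r -> 0 <= L ->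
  compactly_contained (E `+` F) (eball x r) -> measurable E -> measurable F ->
  (perimeter E < +oo)%E ->
  (perimeter E <= perimeter F + L%:E * leb (E `+` F))%E ->
  (perimeter_in E (eball x r) <= perimeter_in F (eball x r) + L%:E * leb (E `+` F))%E.
Proof.
move=> r0 L0 cEF mE mF PE EF.
have mEF := measurable_symdiff mE mF.
have fd : leb (E `+` F) \is a fin_num.
  rewrite ge0_fin_numE//; apply: le_lt_trans (eball_fin x r).
  apply: le_measure; rewrite ?inE//; first exact: measurable_eball.
  by move=> y EFy; apply: cEF.2; exact: subset_closure.
have PF0 := @perimeter_ge0 R n (eball x r) F mF.
have Ld : (L%:E * leb (E `+` F))%E = (L * fine (leb (E `+` F)))%:E.
  by rewrite -{1}(fineK fd).
have [PFy|] := boolP (perimeter_in F (eball x r) < +oo)%E; last first.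
  by rewrite -leNgt leye_eq => /eqP ->; rewrite Ld addye ?leey.
have fPE : perimeter E \is a fin_num by rewrite ge0_fin_numE// perimeter_ge0.
have fPF : perimeter_in F (eball x r) \is a fin_num by rewrite ge0_fin_numE.
apply: perimeter_le => // psi cpsi psi1.
have H : (perimeter F <= (fine (perimeter E) + fine (perimeter_in F (eball x r)) -
    \int[leb]_(y in E) divergence psi y)%:E)%E.
  apply: perimeter_le => // phi cphi phi1.
  have := test_field_exchange r0 cEF mE mF cphi phi1 cpsi psi1.
  by rewrite -(fineK fPE) -(fineK fPF) -EFinD !lee_fin lerBrDl.
have := le_trans EF (leeD2r (L%:E * leb (E `+` F))%E H).
by rewrite Ld -(fineK fPE) -(fineK fPF) -!EFinD !lee_fin; lra.
Qed.

End localization.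

(** * Volume and asymmetry *)

Section volume.
Context {R : realType} {n : nat}.
Local Notation leb := (@lebesgue R n).
Implicit Types (x y : 'rV[R]_n) (A B C E F : set (eucl R n)).

Definition vol A : R := fine (leb A).

Lemma vol_ge0 A : 0 <= vol A. Proof. exact: fine_ge0. Qed.

Lemma vol_eball x r : 0 < r -> vol (eball x r) = r ^+ n * vol (eball 0 1).
Proof.
move=> r0; rewrite /vol lebesgue_eball// fineM//.
by rewrite ge0_fin_numE// lebesgue_unit_ball_fin.
Qed.

Lemma unit_ball_fin_num : leb (eball 0 1) \is a fin_num.
Proof. by rewrite ge0_fin_numE// lebesgue_unit_ball_fin. Qed.

Lemma vol_unit_ball_gt0 : 0 < vol (eball 0 1).
Proof.
by rewrite -lte_fin /vol fineK ?unit_ball_fin_num//; exact: lebesgue_unit_ball_gt0.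
Qed.

Lemma Sn_fin E : Sn E -> leb E \is a fin_num.
Proof. by case=> _ /andP[_ Efin]; rewrite ge0_fin_numE. Qed.

Lemma Sn_vol_gt0 E : Sn E -> 0 < vol E.
Proof. by move=> SE; rewrite -lte_fin /vol fineK ?Sn_fin//; case: SE => _ /andP[]. Qed.

Lemma Sn_eball x r : 0 < r -> Sn (eball x r : set (eucl R n)).
Proof.
move=> r0; split; first exact: measurable_eball.
rewrite eball_fin andbT lebesgue_eball// mule_gt0//; last exact: lebesgue_unit_ball_gt0.
by rewrite lte_fin exprn_gt0.
Qed.

Lemma symdiff_fin A B : measurable A -> measurable B ->
  leb A \is a fin_num -> leb B \is a fin_num -> leb (A `+` B) \is a fin_num.
Proof.
move=> mA mB; rewrite !ge0_fin_numE// => fA fB.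
apply: (@le_lt_trans _ _ (leb (A `|` B))).
  apply: le_measure; rewrite ?inE; [exact: measurable_symdiff|exact: measurableU|].
  by move=> x [[]|[]]; [left|right].
by apply: (le_lt_trans (measureU2 _ mA mB)); exact: lte_add_pinfty.
Qed.

Lemma vol_symdiff_triangle A B C : Sn A -> Sn B -> Sn C ->
  vol (A `+` C) <= vol (A `+` B) + vol (B `+` C).
Proof.
move=> SA SB SC; have [[[mA _] [mB _]] [mC _]] := (SA, SB, SC).
have [[fA fB] fC] := (Sn_fin SA, Sn_fin SB, Sn_fin SC).
rewrite /vol -fineD ?symdiff_fin//; apply: fine_le; rewrite ?fin_numD ?symdiff_fin//.
exact: symdiff_triangle.
Qed.

Lemma vol_le_symdiff A B : measurable A -> measurable B -> leb B \is a fin_num ->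
  leb (A `+` B) \is a fin_num -> vol A <= vol B + vol (A `+` B).
Proof.
move=> mA mB fB fAB; rewrite /vol -fineD//.
have H : (leb A <= leb B + leb (A `+` B))%E.
  apply: le_trans (measureU2 _ mB (measurable_symdiff mA mB)).
  apply: le_measure; rewrite ?inE//.
    by apply: measurableU => //; exact: measurable_symdiff.
  move=> x Ax; have [Bx|nBx] := pselect (B x); first by left.
  by right; left.
apply: fine_le => //; last by rewrite fin_numD fB fAB.
rewrite ge0_fin_numE//; apply: (le_lt_trans H).
by rewrite lte_add_pinfty// -ge0_fin_numE.
Qed.

Lemma vol_symdiff_concentric x r s : 0 < r -> 0 < s ->
  vol (eball x r `+` eball x s) = `|vol (eball x r) - vol (eball x s)|.
Proof.
wlog rs : r s / r <= s => [H r0 s0|r0 s0].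
  have [rs|/ltW sr] := leP r s; first exact: H.
  by rewrite symdiffC distrC; exact: H.
have sub : eball x r `<=` eball x s by move=> y /lt_le_trans; apply.
have -> : eball x r `+` eball x s = eball x s `\` eball x r.
  apply/seteqP; split=> [y [[yr ys]|//]|y ys]; last by right.
  by have := ys (sub _ yr).
have fs := Sn_fin (Sn_eball x s0); have fr := Sn_fin (Sn_eball x r0).
have := @measureD _ _ _ leb _ _ (measurable_eball x s) (measurable_eball x r) (eball_fin x s).
rewrite setIidr// /vol => ->; rewrite fineB// distrC ger0_norm// subr_ge0.
apply: fine_le => //; apply: le_measure; rewrite ?inE//; exact: measurable_eball.
Qed.

End volume.

Section asymmetry.
Context {R : realType} {n : nat}.
Hypothesis n0 : (0 < n)%N.
Local Notation leb := (@lebesgue R n).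
Local Notation omega := (@vol R n (eball 0 1)).
Implicit Types (x y : 'rV[R]_n) (E F : set (eucl R n)).

Lemma eq_ball_radiusP E : Sn E ->
  0 < eq_ball_radius E /\ leb (eball 0 (eq_ball_radius E)) = leb E.
Proof.
move=> SE; have v0 := Sn_vol_gt0 SE; have w0 := @vol_unit_ball_gt0 R n.
rewrite /eq_ball_radius.
suff : [set r : R | 0 < r /\ leb (eball 0 r) = leb E] !=set0.
  by move=> /(xgetPex 0).
pose r := (vol E / omega) `^ n%:R^-1.
have r0 : 0 < r by rewrite powR_gt0// divr_gt0.
exists r; split => //.
rewrite -[LHS]fineK ?Sn_fin//; last exact: Sn_eball.
rewrite -[RHS]fineK ?Sn_fin// -/(vol _) vol_eball//.
rewrite -powR_mulrn ?(ltW r0)// -powRrM mulVf ?pnatr_eq0 -?lt0n//.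
by rewrite powRr1 ?divfK ?gt_eqF// divr_ge0// ltW.
Qed.

Lemma vol_eq_ball E x : Sn E -> vol (eball x (eq_ball_radius E)) = vol E.
Proof.
by move=> SE; have [r0 E0] := eq_ball_radiusP SE; rewrite vol_eball// -(vol_eball 0)// /vol E0.
Qed.

Lemma eq_ball_radius_vol E : Sn E -> vol E = eq_ball_radius E ^+ n * omega.
Proof.
by move=> SE; have [r0 _] := eq_ball_radiusP SE; rewrite -(vol_eball 0)// vol_eq_ball.
Qed.

Lemma eq_ball_translate E x : [set x + y | y in eq_ball E] = eball x (eq_ball_radius E).
Proof.
apply/seteqP; split=> [_ [y yE <-]|y yE].
  by move: yE; rewrite /eq_ball /eball /= subr0 addrAC subrr add0r.
by exists (y - x); [rewrite /eq_ball /eball /= subr0|rewrite addrC subrK].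
Qed.

Definition ball_distance E x : R := vol (E `+` eball x (eq_ball_radius E)) / vol E.

Lemma asymmetryE E : Sn E ->
  asymmetry E = inf [set ball_distance E x | x in [set: 'rV[R]_n]].
Proof.
move=> SE; rewrite /asymmetry; congr inf; apply: eq_imagel => x _.
rewrite eq_ball_translate /ball_distance.
have [r0 leE] := eq_ball_radiusP SE; rewrite /eq_ball leE.
have fE := Sn_fin SE; have fd : leb (E `+` eball x (eq_ball_radius E)) \is a fin_num.
  apply: symdiff_fin => //; [by case: SE|exact: measurable_eball|].
  exact: (Sn_fin (Sn_eball x r0)).
rewrite -[in LHS](fineK fE) inver gt_eqF; last exact: Sn_vol_gt0.
by rewrite -(fineK fd) -EFinM.
Qed.

Let has_inf_ball_distance E : Sn E -> has_inf [set ball_distance E x | x in [set: 'rV[R]_n]].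
Proof.
move=> SE; split; first by exists (ball_distance E 0), 0.
by exists 0 => _ [x _ <-]; rewrite divr_ge0// vol_ge0.
Qed.

Lemma asymmetry_le E x : Sn E -> asymmetry E <= ball_distance E x.
Proof.
move=> SE; rewrite asymmetryE//; apply: ge_inf; last by exists x.
by have [] := has_inf_ball_distance SE.
Qed.

Lemma asymmetry_ge E b : Sn E -> (forall x, b <= ball_distance E x) -> b <= asymmetry E.
Proof.
move=> SE H; rewrite asymmetryE//; apply: lb_le_inf; last by move=> _ [x _ <-].
by have [] := has_inf_ball_distance SE.
Qed.

Lemma asymmetry_ge0 E : Sn E -> 0 <= asymmetry E.
Proof. by move=> SE; apply: asymmetry_ge => // x; rewrite divr_ge0// vol_ge0. Qed.

Lemma asymmetry_le2 E : Sn E -> asymmetry E <= 2.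
Proof.
move=> SE; apply: le_trans (asymmetry_le 0 SE) _.
have v0 := Sn_vol_gt0 SE; have [r0 _] := eq_ball_radiusP SE.
rewrite ler_pdivrMr// mulr_natl mulr2n -[X in _ <= _ + X](vol_eq_ball 0 SE).
have SB := Sn_eball (0 : 'rV[R]_n) r0.
have [[mE _] [mB _]] := (SE, SB); have [fE fB] := (Sn_fin SE, Sn_fin SB).
rewrite /vol -fineD//; apply: fine_le; rewrite ?fin_numD ?fE ?fB ?symdiff_fin//.
apply: le_trans (measureU2 _ mE mB).
apply: le_measure; rewrite ?inE; [exact: measurable_symdiff|exact: measurableU|].
by move=> x [[]|[]]; [left|right].
Qed.

Lemma asymmetry_approx E e : Sn E -> 0 < e -> exists x, ball_distance E x < asymmetry E + e.
Proof.
move=> SE e0; rewrite asymmetryE//.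
by have [_ [x _ <-] H] := inf_adherent e0 (has_inf_ball_distance SE); exists x.
Qed.

(** For each centre x the ball of volume |F| competes for F with the ball of volume |E|
    for E: the two balls are concentric, so they differ by ||E| - |F||, which is at
    most the volume of the symmetric difference of E and F. *)
Lemma asymmetry_transfer E F : Sn E -> Sn F ->
  asymmetry F * vol F <= asymmetry E * vol E + 2 * vol (E `+` F).
Proof.
move=> SE SF; have [vE vF] := (Sn_vol_gt0 SE, Sn_vol_gt0 SF).
have [rE _] := eq_ball_radiusP SE; have [rF _] := eq_ball_radiusP SF.
rewrite -lerBlDr -ler_pdivrMr//; apply: asymmetry_ge => // x.
rewrite ler_pdivrMr// /ball_distance divfK ?gt_eqF// lerBlDr.
have := asymmetry_le x SF; rewrite /ball_distance ler_pdivlMr// => /le_trans; apply.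
have SBE := Sn_eball x rE; have SBF := Sn_eball x rF.
have H1 := vol_symdiff_triangle SF SE SBF.
have H2 := vol_symdiff_triangle SE SBE SBF.
have H3 := vol_symdiff_concentric x rE rF; rewrite !vol_eq_ball// in H3.
have [[mE _] [mF _]] := (SE, SF); have [fE fF] := (Sn_fin SE, Sn_fin SF).
have H4 := vol_le_symdiff mE mF fF (symdiff_fin mE mF fE fF).
have H5 := vol_le_symdiff mF mE fE (symdiff_fin mF mE fF fE).
rewrite (symdiffC F E) in H1 H5.
have : `|vol E - vol F| <= vol (E `+` F) by rewrite ler_norml; apply/andP; split; lra.
by rewrite -H3; lra.
Qed.

Lemma near_unit_balls E : Sn E -> eq_ball_radius E = 1 -> asymmetry E = 0 ->
  forall e : R, 0 < e -> exists y, (leb (E `+` eball y 1) < e%:E)%E.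
Proof.
move=> SE rE aE e e0; have vE := Sn_vol_gt0 SE.
have [y] := asymmetry_approx SE (divr_gt0 e0 vE).
rewrite aE add0r /ball_distance ltr_pM2r ?invr_gt0// rE => H; exists y.
rewrite -[X in (X < _)%E]fineK ?lte_fin//.
by apply: symdiff_fin => //; [case: SE|exact: measurable_eball|exact: Sn_fin|exact/Sn_fin/Sn_eball].
Qed.

End asymmetry.

(** * The functional and the finiteness of its minimum *)

Section two_balls.
Context {R : realType} {n : nat}.
Hypothesis n0 : (0 < n)%N.
Local Notation leb := (@lebesgue R n).
Local Notation omega := (@vol R n (eball 0 1)).
Implicit Types (x y : 'rV[R]_n) (E F : set (eucl R n)).

(** A competitor at which the functional is finite.  It is the union of two unit balls
    with centres at distance 6: a ball of the same volume has radius at most 2, so it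
    meets at most one of them, and the asymmetry is at least 1/2. *)
Lemma exists_asymmetric_set : exists G : set (eucl R n),
  [/\ Sn G, 0 < asymmetry G & (perimeter G < +oo)%E].
Proof.
pose e : 'rV[R]_n := delta_mx 0 (Ordinal n0).
have e1 : enorm e = 1.
  rewrite enormE /dot (bigD1 (Ordinal n0))//= big1 ?addr0 => [|j ji].
    by rewrite mxE !eqxx mulr1 sqrtr1.
  by rewrite mxE (negbTE ji) andbF mulr0.
pose c1 : 'rV[R]_n := 3 *: e; pose c2 : 'rV[R]_n := - c1.
have c12 : enorm (c1 - c2) = 6.
  by rewrite /c2 opprK -scalerDl enormZ e1 mulr1 ger0_norm//; lra.
pose B1 : set (eucl R n) := eball c1 1; pose B2 : set (eucl R n) := eball c2 1.
have [mB1 mB2] : measurable B1 /\ measurable B2 by split; exact: measurable_eball.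
have dist x y : enorm (c1 - x) < 1 -> enorm (y - c2) < 1 -> 4 < enorm (x - y).
  move=> H1 H2.
  have := enormD (c1 - x) (x - y); have := enormD (c1 - y) (y - c2).
  rewrite !addrA !subrK c12; lra.
have dB : B1 `&` B2 = set0.
  apply/seteqP; split=> // x [H1 H2].
  have := dist x x; rewrite subrr enorm0 => /(_ _ H2).
  by rewrite enormB => /(_ H1); lra.
pose G := B1 `|` B2; have mG : measurable G by exact: measurableU.
have lG : leb G = (2 * omega)%:E.
  have -> : leb G = (leb B1 + leb B2)%E by exact: measureU.
  rewrite !lebesgue_eball1 -(fineK unit_ball_fin_num) -EFinD; congr EFin.
  by rewrite mulr_natl mulr2n.
have w0 := @vol_unit_ball_gt0 R n.
have SG : Sn G by split => //; rewrite lG ltry lte_fin mulr_gt0.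
have vG : vol G = 2 * omega by rewrite /vol lG.
have [r0 _] := eq_ball_radiusP n0 SG.
have r2 : eq_ball_radius G <= 2.
  have rn : eq_ball_radius G ^+ n = 2.
    have := eq_ball_radius_vol n0 SG; rewrite vG => /eqP; rewrite -subr_eq0 -mulrBl mulf_eq0.
    by rewrite subr_eq0 (gt_eqF w0) orbF => /eqP.
  rewrite leNgt; apply/negP => r2.
  have : eq_ball_radius G <= eq_ball_radius G ^+ n.
    by rewrite ler_eXnr//; lra.
  by rewrite rn leNgt r2.
have far x : B1 `<=` G `+` eball x (eq_ball_radius G) \/ B2 `<=` G `+` eball x (eq_ball_radius G).
  have [[p [p1 px]]|H] := pselect (exists p, B1 p /\ eball x (eq_ball_radius G) p).
    right=> q Bq; left; split; first by right.
    move=> qx; have := dist p q; rewrite enormB => /(_ p1 Bq).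
    have := enormD (p - x) (x - q); rewrite addrA subrK (enormB x q).
    by move: px qx; rewrite /eball /=; lra.
  by left=> p Bp; left; split; [left|move=> px; apply: H; exists p].
exists G; split => //.
  apply: (@lt_le_trans _ _ (1 / 2)) => //; apply: asymmetry_ge => // x.
  have SB := Sn_eball x r0.
  have fS := symdiff_fin mG (measurable_eball x _) (Sn_fin SG) (Sn_fin SB).
  rewrite /ball_distance vG ler_pdivlMr ?mulr_gt0//.
  have -> : 1 / 2 * (2 * omega) = omega by field.
  have mS := measurable_symdiff mG (measurable_eball x (eq_ball_radius G)).
  have sub c : eball c 1 `<=` G `+` eball x (eq_ball_radius G) ->
      omega <= vol (G `+` eball x (eq_ball_radius G)).
    move=> cS; have -> : omega = vol (eball c 1) by rewrite /vol lebesgue_eball1.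
    apply: fine_le => //; first exact: (Sn_fin (Sn_eball c ltr01)).
    by apply: le_measure; rewrite ?inE//; exact: measurable_eball.
  by case: (far x); exact: sub.
apply: (@le_lt_trans _ _ (n%:R * omega + n%:R * omega)%:E); last exact: ltry.
apply: perimeter_le => // S cS S1.
have [M sS] := C1c_supported cS; have CS := C1c_C1 cS.
rewrite Rintegral_setU//; last 2 first.
- exact: (divergence_integrable CS sS).
- by apply/disj_setPS; rewrite dB.
rewrite lee_fin; apply: lerD.
  by have := ball_flux_le c1 ltr01 CS sS S1; rewrite divr1 lebesgue_eball1.
by have := ball_flux_le c2 ltr01 CS sS S1; rewrite divr1 lebesgue_eball1.
Qed.

End two_balls.

Section functional.
Context {R : realType} {n : nat}.
Hypothesis n0 : (0 < n)%N.
Variables (f g : R -> R).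
Local Notation leb := (@lebesgue R n).
Local Notation omega := (@vol R n (eball 0 1)).
Implicit Types (x y : 'rV[R]_n) (E F : set (eucl R n)).
Hypothesis g_gt0 : forall t, 0 < t -> t <= 2 -> 0 < g t.

Definition eq_ball_perimeter E : R := n%:R / eq_ball_radius E * vol E.

Lemma eq_ball_perimeterE E : Sn E -> perimeter (eq_ball E) = (eq_ball_perimeter E)%:E.
Proof.
move=> SE; have [r0 leE] := eq_ball_radiusP n0 SE.
by rewrite /eq_ball perimeter_eball// leE.
Qed.

Lemma eq_ball_perimeter_gt0 E : Sn E -> 0 < eq_ball_perimeter E.
Proof.
move=> SE; have [r0 _] := eq_ball_radiusP n0 SE.
by rewrite /eq_ball_perimeter mulr_gt0 ?Sn_vol_gt0// divr_gt0// ltr0n.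
Qed.

Lemma functional_fin E : Sn E -> 0 < asymmetry E -> (perimeter E < +oo)%E ->
  functional f g E = ((fine (perimeter E) / eq_ball_perimeter E - 1 + f (asymmetry E)) /
    g (asymmetry E))%:E.
Proof.
move=> SE a0 PE; have [mE _] := SE.
have fP : perimeter E \is a fin_num by rewrite ge0_fin_numE// perimeter_ge0.
have p0 := eq_ball_perimeter_gt0 SE.
rewrite /functional a0 /functional_pos /deficit eq_ball_perimeterE// -{1}(fineK fP).
rewrite !inver !gt_eqF//; last by apply: g_gt0 => //; exact: asymmetry_le2.
transitivity ((((fine (perimeter E) - eq_ball_perimeter E) / eq_ball_perimeter E +
  f (asymmetry E)) / g (asymmetry E))%:E) => //.
by rewrite mulrBl divff// gt_eqF.
Qed.

Lemma functional_infinite E : Sn E -> 0 < asymmetry E -> perimeter E = +oo%E ->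
  functional f g E = +oo%E.
Proof.
move=> SE a0 PE; have p0 := eq_ball_perimeter_gt0 SE.
have ga : 0 < g (asymmetry E) by apply: g_gt0 => //; exact: asymmetry_le2.
rewrite /functional a0 /functional_pos /deficit eq_ball_perimeterE// PE.
by rewrite !inver !gt_eqF// addye// gt0_mulye ?lte_fin ?invr_gt0// addye// gt0_mulye ?lte_fin ?invr_gt0.
Qed.

(** An infinite perimeter would make the functional infinite, but it is finite
    somewhere. *)
Lemma minimizer_perimeter_fin E : minimizer f g E -> 0 < asymmetry E ->
  (perimeter E < +oo)%E.
Proof.
move=> [SE minE] a0; rewrite ltey; apply/eqP => PE.
have [G [SG aG PG]] := @exists_asymmetric_set R n n0.
have := minE G SG; rewrite functional_infinite// functional_fin//.
Qed.

Lemma minimizer_value E : minimizer f g E ->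
  functional f g E = ereal_inf [set functional f g F | F in @Sn R n].
Proof.
move=> [SE minE]; apply/eqP; rewrite eq_le; apply/andP; split.
  by apply: le_ereal_inf_tmp => _ [F SF <-]; exact: minE.
by apply: ereal_inf_lbound; exists E.
Qed.

End functional.

Lemma lipschitz_bound (R : realType) (h : R -> R) :
  [lipschitz h x | x in `[0, 2]] ->
  exists2 K, 0 <= K & forall s t, 0 <= s <= 2 -> 0 <= t <= 2 ->
    `|h s - h t| <= K * `|s - t|.
Proof.
move=> [M [_ HM]]; exists (`|M| + 1); first by rewrite addr_ge0.
move=> s t s02 t02.
have M1 : M < `|M| + 1 by rewrite ltr_pwDr// ler_norm.
by apply: (HM _ M1 (s, t)); split; rewrite /= in_itv.
Qed.

(** * Comparison of a minimizer with its perturbations *)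

(** The data stand for w = |B|, p = P(E), p1 = P(B), q = P(F), qb = P(B_F), d the volume
    of the symmetric difference of E and F, m the minimum, D the difference of the
    asymmetries, and P an upper bound for p.  The two hypotheses on m bound
    p / p1 - q / qb; replacing qb by p1 costs a multiple of q d, and one may assume
    q <= p <= P. *)
Lemma comparison_estimate (R : realFieldType) (w p p1 q qb d m fa fb ga gb Kf Kg D P : R) :
  0 < w -> 0 < p1 -> 0 <= q -> 0 < qb -> 0 <= d -> 0 <= Kf -> 0 <= Kg -> 0 <= P ->
  p / p1 - 1 + fa = m * ga -> m * gb <= q / qb - 1 + fb ->
  `|fa - fb| <= Kf * D -> `|ga - gb| <= Kg * D -> D <= 4 * d / w ->
  p1 <= qb * (1 + 2 * d / w) -> p <= P ->
  p <= q + (2 * P + 4 * p1 * (`|m| * Kg + Kf)) / w * d.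
Proof.
move=> w0 p10 q0 qb0 d0 Kf0 Kg0 P0 pE qE fD gD Dd p1qb pP.
have m0 := normr_ge0 m.
have X0 : 0 <= `|m| * Kg + Kf by rewrite addr_ge0// mulr_ge0.
have dw : 0 <= d / w by rewrite divr_ge0// ltW.
have [pq|qp] := leP p q.
  rewrite (le_trans pq)// lerDl mulr_ge0// divr_ge0 ?(ltW w0)//.
  by rewrite addr_ge0 ?mulr_ge0// ltW.
have T : p / p1 - q / qb <= (`|m| * Kg + Kf) * (4 * d / w).
  have mg : m * (ga - gb) <= `|m| * (Kg * D).
    by apply: (le_trans (ler_norm _)); rewrite normrM ler_wpM2l.
  have f1 : fb - fa <= Kf * D by move: fD; rewrite ler_norml; lra.
  have : (`|m| * Kg + Kf) * D <= (`|m| * Kg + Kf) * (4 * d / w) by rewrite ler_wpM2l.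
  lra.
have H1 : p <= p1 * (q / qb) + p1 * ((`|m| * Kg + Kf) * (4 * d / w)).
  by rewrite -mulrDr mulrC -ler_pdivrMr// -lerBlDl.
have H2 : p1 * (q / qb) <= q * (1 + 2 * d / w).
  rewrite mulrA ler_pdivrMr// (mulrC p1) -[leRHS]mulrA (mulrC _ qb).
  exact: ler_wpM2l.
have H3 : q * (2 * d / w) <= P * (2 * d / w).
  rewrite ler_wpM2r//; last exact: le_trans (ltW qp) pP.
  by rewrite -mulrA mulr_ge0.
have -> : (2 * P + 4 * p1 * (`|m| * Kg + Kf)) / w * d =
  P * (2 * d / w) + p1 * ((`|m| * Kg + Kf) * (4 * d / w)) by field; rewrite gt_eqF.
by move: H2; rewrite mulrDr mulr1; lra.
Qed.

Section comparison.
Context {R : realType} {n : nat}.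
Hypothesis n0 : (0 < n)%N.
Variables (f g : R -> R) (Kf Kg : R).
Local Notation leb := (@lebesgue R n).
Local Notation omega := (@vol R n (eball 0 1)).
Implicit Types (x y : 'rV[R]_n) (E F : set (eucl R n)).
Hypotheses (Kf0 : 0 <= Kf) (Kg0 : 0 <= Kg).
Hypothesis f_lip : forall s t, 0 <= s <= 2 -> 0 <= t <= 2 -> `|f s - f t| <= Kf * `|s - t|.
Hypothesis g_lip : forall s t, 0 <= s <= 2 -> 0 <= t <= 2 -> `|g s - g t| <= Kg * `|s - t|.
Hypothesis g0 : g 0 = 0.
Hypothesis g_gt0 : forall t, 0 < t -> t <= 2 -> 0 < g t.

(** All minimizers share this value, which makes the constants below uniform. *)
Definition infimum : R := fine (ereal_inf [set functional f g F | F in @Sn R n]).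

Definition perimeter_bound : R :=
  n%:R * omega * (1 + `|infimum| * (2 * Kg) + (`|f 0| + 2 * Kf)).

Definition comparison_constant : R :=
  (2 * perimeter_bound + 4 * (n%:R * omega) * (`|infimum| * Kg + Kf)) / omega.

Lemma unit_eq_ball_radius E : Sn E -> leb E = leb (eball 0 1) -> eq_ball_radius E = 1.
Proof.
move=> SE lE; have w0 := @vol_unit_ball_gt0 R n; have [r0 _] := eq_ball_radiusP n0 SE.
have := eq_ball_radius_vol n0 SE; rewrite /vol lE -/(vol _) => /eqP.
rewrite -[X in X == _]mul1r -subr_eq0 -mulrBl mulf_eq0 (gt_eqF w0) orbF subr_eq0 eq_sym.
by rewrite pexpr_eq1// ?(ltW r0)// => /eqP.
Qed.

(** The perimeter of B_F is n |F| / r.  If its radius r is at least 1, then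
    |F| / r = r^(n-1) |B| is at least |B|; if r < 1, then |F| / r is at least |F|, which
    is at least |B| - d. *)
Lemma eq_ball_perimeter_le F d : Sn F -> 0 <= d -> d <= omega / 2 -> omega <= vol F + d ->
  n%:R * omega <= eq_ball_perimeter F * (1 + 2 * d / omega).
Proof.
move=> SF d0 dw wF; have w0 := @vol_unit_ball_gt0 R n.
have [r0 _] := eq_ball_radiusP n0 SF; have vF := eq_ball_radius_vol n0 SF.
have dw0 : 0 <= 2 * d / omega by rewrite divr_ge0 ?mulr_ge0// ltW.
rewrite /eq_ball_perimeter; set r := eq_ball_radius F in r0 vF *.
have -> : n%:R / r * vol F * (1 + 2 * d / omega) =
  n%:R * (r^-1 * (vol F * (1 + 2 * d / omega))) by rewrite !mulrA.
rewrite ler_wpM2l//.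
have [r1|r1] := leP 1 r.
  have : omega <= r^-1 * vol F.
    rewrite vF mulrA ler_peMl ?(ltW w0)//.
    by rewrite -(prednK n0) exprS mulrA mulVf ?gt_eqF// mul1r exprn_ege1.
  by rewrite mulrA => /le_trans; apply; rewrite ler_peMr ?lerDl// mulr_ge0 ?vol_ge0// invr_ge0 ltW.
have vF0 : 0 <= vol F by exact: vol_ge0.
have ri : 1 <= r^-1 by rewrite -invr1 lef_pV2 ?posrE// ltW.
have H : omega <= vol F * (1 + 2 * d / omega).
  have : (omega - d) * (1 + 2 * d / omega) <= vol F * (1 + 2 * d / omega).
    by rewrite ler_wpM2r ?addr_ge0// lerBlDr.
  apply: le_trans.
  have -> : (omega - d) * (1 + 2 * d / omega) = omega + d * (omega / 2 - d) * 2 / omega.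
    by field; rewrite gt_eqF.
  by rewrite lerDl divr_ge0 ?(ltW w0)// mulr_ge0// mulr_ge0// subr_ge0.
by apply: (le_trans H); rewrite ler_peMl// mulr_ge0// addr_ge0.
Qed.

(** The comparison argument.  A competitor F close to a minimizer E of positive
    asymmetry has positive asymmetry too, so minimality bounds the difference of the
    deficits by that of the asymmetries, of order the volume of the difference; the
    normalizing perimeters of the balls differ by the same order. *)
Lemma asymmetric_minimizer_comparison E F : minimizer f g E ->
  leb E = leb (eball 0 1) -> 0 < asymmetry E -> measurable F ->
  leb (E `+` F) \is a fin_num -> vol (E `+` F) <= omega / 2 ->
  4 * vol (E `+` F) < asymmetry E * omega ->
  (perimeter E <= perimeter F + comparison_constant%:E * leb (E `+` F))%E.
Proof.
move=> minE lE a0 mF fd dw da; have [SE mini] := minE; have [mE _] := SE.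
have w0 := @vol_unit_ball_gt0 R n.
have vE : vol E = omega by rewrite /vol lE.
set d := vol (E `+` F) in dw da; have d0 : 0 <= d by exact: vol_ge0.
have fE := Sn_fin SE.
have fF : leb F \is a fin_num.
  rewrite ge0_fin_numE//; apply: (@le_lt_trans _ _ (leb E + leb (E `+` F))%E).
    apply: le_trans (measureU2 _ mE (measurable_symdiff mE mF)).
    apply: le_measure; rewrite ?inE//.
      by apply: measurableU => //; exact: measurable_symdiff.
    move=> x Fx; have [Ex|nEx] := pselect (E x); first by left.
    by right; right.
  by rewrite lte_add_pinfty// -ge0_fin_numE.
have EF : omega <= vol F + d by rewrite -vE; exact: vol_le_symdiff.
have FE : vol F <= omega + d.
  by rewrite -vE /d symdiffC; apply: vol_le_symdiff => //; rewrite symdiffC.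
have vF : 0 < vol F by lra.
have SF : Sn F.
  split=> //; rewrite -ge0_fin_numE// fF andbT.
  by rewrite -(fineK fF) lte_fin.
pose a := asymmetry E; pose b := asymmetry F.
have a2 : a <= 2 := asymmetry_le2 n0 SE; have b2 : b <= 2 := asymmetry_le2 n0 SF.
have b0' : 0 <= b := asymmetry_ge0 n0 SF.
have H1 := asymmetry_transfer n0 SE SF; have H2 := asymmetry_transfer n0 SF SE.
rewrite vE (symdiffC F E) -/d -/a -/b in H1 H2; rewrite -/a in da a0.
have ab : `|a - b| <= 4 * d / omega.
  rewrite ler_pdivlMr// -(ger0_norm (ltW w0)) -normrM mulrBl ler_norml.
  by apply/andP; split; nra.
have b0 : 0 < b.
  rewrite -(pmulr_rgt0 _ w0); nra.
have [PFy|] := boolP (perimeter F < +oo)%E; last first.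
  have cc : 0 <= comparison_constant.
    rewrite /comparison_constant divr_ge0 ?(ltW w0)//.
    rewrite !(addr_ge0, mulr_ge0)// ltW//.
  rewrite -leNgt leye_eq => /eqP ->; rewrite -(fineK fd) -EFinM addye ?leey//.
have PEy : (perimeter E < +oo)%E by exact: (minimizer_perimeter_fin n0 g_gt0 minE).
have fPE : perimeter E \is a fin_num by rewrite ge0_fin_numE// perimeter_ge0.
have fPF : perimeter F \is a fin_num by rewrite ge0_fin_numE// perimeter_ge0.
have mE' := minimizer_value minE.
have FEval := functional_fin n0 f g_gt0 SE a0 PEy.
have FFval := functional_fin n0 f g_gt0 SF b0 PFy.
have infE : infimum = (fine (perimeter E) / eq_ball_perimeter E - 1 + f a) / g a.
  by rewrite /infimum -mE' FEval.
have ga : 0 < g a by exact: g_gt0.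
have gb : 0 < g b by exact: g_gt0.
have pE : eq_ball_perimeter E = n%:R * omega.
  by rewrite /eq_ball_perimeter unit_eq_ball_radius// divr1 vE.
rewrite pE in infE.
have eqE : fine (perimeter E) / (n%:R * omega) - 1 + f a = infimum * g a.
  by rewrite infE divfK// gt_eqF.
have leF : infimum * g b <= fine (perimeter F) / eq_ball_perimeter F - 1 + f b.
  rewrite -ler_pdivlMr// -lee_fin -FFval infE -pE -FEval.
  exact: mini.
have p10 : 0 < n%:R * omega by rewrite mulr_gt0// ltr0n.
have a02 : 0 <= a <= 2 by rewrite (ltW a0).
have b02 : 0 <= b <= 2 by rewrite b0'.
have z02 : 0 <= (0 : R) <= 2 by rewrite lexx ler0n.
have PB : 0 <= perimeter_bound.
  rewrite /perimeter_bound mulr_ge0 ?(ltW p10)//.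
  by rewrite !(addr_ge0, mulr_ge0).
have pP : fine (perimeter E) <= perimeter_bound.
  rewrite /perimeter_bound mulrC -ler_pdivrMr//.
  have -> : fine (perimeter E) / (n%:R * omega) = 1 + infimum * g a - f a by lra.
  have Hg : infimum * g a <= `|infimum| * (2 * Kg).
    apply: (le_trans (ler_norm _)); rewrite normrM ler_wpM2l//.
    have := g_lip a02 z02; rewrite g0 !subr0 (ger0_norm (ltW a0)) => /le_trans; apply.
    by rewrite mulrC ler_wpM2r.
  have Hf : - f a <= `|f 0| + 2 * Kf.
    have := f_lip z02 a02; rewrite sub0r normrN (ger0_norm (ltW a0)).
    have : Kf * a <= 2 * Kf by rewrite mulrC ler_wpM2r.
    have := ler_norm (f 0 - f a); have := ler_norm (- f 0); rewrite normrN; lra.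
  lra.
have qb := eq_ball_perimeter_le SF d0 dw EF.
have q0 : 0 <= fine (perimeter F) by apply: fine_ge0; exact: perimeter_ge0.
have := comparison_estimate w0 p10 q0 (eq_ball_perimeter_gt0 n0 SF) d0 Kf0 Kg0 PB
  eqE leF (f_lip a02 b02) (g_lip a02 b02) ab qb pP.
by rewrite -(fineK fPE) -(fineK fPF) -(fineK fd) -EFinM -EFinD lee_fin.
Qed.

End comparison.

Unset Implicit Arguments.

Theorem theorem3p3 (R : realType) (n : nat) (f g : R -> R) :
  (2 <= n)%N ->
  [lipschitz f x | x in `[0, 2]] ->
  [lipschitz g x | x in `[0, 2]] ->
  (forall t, t \in `[0, 2] -> 0 <= g t) ->
  (forall t, t \in `[0, 2] -> (g t = 0 <-> t = 0)) ->
  exists2 Lambda : R, 0 < Lambda &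
    forall E : set (eucl R n), minimizer f g E ->
      lebesgue E = lebesgue (@unit_ball R n) -> Lambda_minimizer Lambda E.
Proof.
move=> n2 lf lg g_ge0 g_eq0; have n0 : (0 < n)%N by exact: leq_trans n2.
have [Kf Kf0 f_lip] := lipschitz_bound lf.
have [Kg Kg0 g_lip] := lipschitz_bound lg.
have g0 : g 0 = 0 by apply/g_eq0 => //; rewrite in_itv/= lexx ler0n.
have g_gt0 t : 0 < t -> t <= 2 -> 0 < g t.
  move=> t0 t2; have t02 : t \in `[0, 2] by rewrite in_itv/= (ltW t0).
  rewrite lt_neqAle g_ge0// andbT eq_sym; apply/eqP => /(g_eq0 t t02) tE.
  by rewrite tE ltxx in t0.
have w0 := @vol_unit_ball_gt0 R n.
pose C := comparison_constant (n := n) f g Kf Kg.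
have C0 : 0 <= C.
  rewrite /C /comparison_constant /perimeter_bound divr_ge0 ?(ltW w0)//.
  by rewrite !(addr_ge0, mulr_ge0)// ltW.
pose L : R := C + (2 * n%:R + 2).
have L0 : 0 < L by rewrite ltr_wpDl// ltr_wpDl// mulr_ge0.
exists L => // E minE lE; have [SE _] := minE; have [mE _] := SE.
have rE : eq_ball_radius E = 1 by exact: unit_eq_ball_radius.
have [PE [t t01 H]] : (perimeter E < +oo)%E /\ exists2 t : R, 0 < t <= 1 &
    forall F : set (eucl R n), measurable F -> lebesgue (E `+` F) \is a fin_num ->
      vol (E `+` F) <= t * @vol R n (eball 0 1) ->
      (perimeter E <= perimeter F + L%:E * lebesgue (E `+` F))%E.
  have mono (F : set (eucl R n)) (c : R) : c <= L ->
      (perimeter E <= perimeter F + c%:E * lebesgue (E `+` F))%E ->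
      (perimeter E <= perimeter F + L%:E * lebesgue (E `+` F))%E.
    by move=> cL /le_trans; apply; rewrite leeD2l// lee_wpmul2r// lee_fin.
  have [a0|a0] := ltP 0 (asymmetry E).
    split; first exact: (minimizer_perimeter_fin n0 g_gt0 minE).
    exists (Num.min (1 / 2) (asymmetry E / 8)).
      by rewrite lt_min ge_min !divr_gt0//=; apply/orP; left; lra.
    move=> F mF fd; rewrite -ler_pdivrMr// le_min !ler_pdivrMr// => /andP[d1 d2].
    apply: (mono _ C); first by rewrite /L lerDl addr_ge0// mulr_ge0.
    apply: (asymmetric_minimizer_comparison n0 Kf0 Kg0 f_lip g_lip g0 g_gt0) => //.
      by lra.
    have := mulr_gt0 a0 w0; lra.
  have aE : asymmetry E = 0 by apply/eqP; rewrite eq_le a0 asymmetry_ge0.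
  have HE := near_unit_balls n0 SE rE aE.
  split; first by apply: (le_lt_trans (perimeter_le_near_unit_balls mE HE)); exact: ltry.
  exists 1 => [|F mF _ _]; first by rewrite ltr01 lexx.
  apply: (mono _ (2 * n%:R + 2)); first by rewrite /L lerDr.
  exact: near_unit_balls_quasiminimal.
have /andP[t0 t1] := t01; split.
  split=> // Omega _ _; exact: le_lt_trans (perimeter_in_le Omega mE) PE.
exists t => // x r F /andP[r0 rt] mF cEF.
have r1 : r <= 1 by rewrite (le_trans (ltW rt)).
have mEF := measurable_symdiff mE mF.
have sub : (lebesgue (E `+` F) <= lebesgue (eball x r))%E.
  apply: le_measure; rewrite ?inE//; first exact: measurable_eball.
  by move=> y EFy; apply: cEF.2; exact: subset_closure.
have fd : lebesgue (E `+` F) \is a fin_num.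
  by rewrite ge0_fin_numE//; apply: le_lt_trans sub (eball_fin x r).
apply: local_comparison => //; first exact: ltW.
apply: H => //; apply: (@le_trans _ _ (vol (eball x r))).
  by apply: fine_le => //; exact: (Sn_fin (Sn_eball x r0)).
rewrite vol_eball// ler_wpM2r ?(ltW w0)// (le_trans _ (ltW rt))//.
by rewrite ler_iXnr// ltW.
Qed.
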